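(* Let $G$ be a locally compact group and let $\omega_1,\omega_2$ be two weight inverses on the dual of $G$. If $A(G,\omega_1)\subseteq A(G,\omega_2)$ (as subsets of $A(G)$), then there is $a\in VN(G)$ such that $\omega_1=\omega_2a$. Furthermore, $A(G,\omega_1)=A(G,\omega_2)$ if and only if $\omega_1=\omega_2a$ for an invertible element $a\in VN(G)$.
   Context: $\lambda$ is the left regular representation of $G$ on $L^2(G)$, $VN(G)=\lambda(G)''$, and $\Gamma:VN(G)\to VN(G)\bar\otimes VN(G)$ is the unique normal $*$-homomorphism with $\Gamma(\lambda(s))=\lambda(s)\otimes\lambda(s)$. A weight inverse on the dual of $G$ is an $\omega\in VN(G)$ with $\omega\omega^*\otimes\omega\omega^*\le\Gamma(\omega\omega^* )$ and $\ker\omega=\ker\omega^*=\{0\}$. $A(G)$ is the Fourier algebra, the predual of $VN(G)$ with pairing $(T,u)=\langle T\xi,\eta\rangle$ for $u(s)=\langle\lambda(s)\xi,\eta\rangle$; for $T\in VN(G)$, $f\in A(G)$, $Tf\in A(G)$ is defined by $(R,Tf)=(RT,f)$, $R\in VN(G)$. For a weight inverse $\omega$, $A(G,\omega):=\omega A(G)=\{\omega f: f\in A(G)\}\subset A(G)$. *)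

(* Defs.v *)
From HB Require Import structures.
From mathcomp Require Import all_boot all_order all_algebra.
From mathcomp Require Import generic_quotient ring_quotient.
From mathcomp Require Import all_classical all_reals all_analysis.
From mathcomp Require Import measurable_realfun complex.

Set Implicit Arguments.
Unset Strict Implicit.
Unset Printing Implicit Defensive.

Import Order.TTheory GRing.Theory Num.Theory.
Import numFieldNormedType.Exports.

Local Open Scope classical_set_scope.
Local Open Scope ring_scope.
Local Open Scope quotient_scope.

Section L2.
Context {d : measure_display} {T : measurableType d} {R : realType}.
Variable mu : {measure set T -> \bar R}.
Local Notation C := R[i].

(* Complex square-integrable functions: |f|^2 = (Re f)^2 + (Im f)^2. *)
Definition sqint : {pred T -> C} := [pred f : T -> C |
  (@complex.Re R \o f \in Lfun mu 2%:E) && (@complex.Im R \o f \in Lfun mu 2%:E)].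

Let le12 : (1 <= 2%:E :> \bar R)%E.
Proof. by rewrite lee_fin ler1n. Qed.

Lemma Lfun2D (f g : T -> R) : f \in Lfun mu 2%:E -> g \in Lfun mu 2%:E ->
  f \+ g \in Lfun mu 2%:E.
Proof. by move=> hf hg; have := @Lfun_addr_closed _ _ _ mu _ le12; case=> _; exact. Qed.

Lemma Lfun2Z (f : T -> R) a : f \in Lfun mu 2%:E -> a \*o f \in Lfun mu 2%:E.
Proof.
move=> hf; have := Lfun_submod_closed mu le12 => -[h0 h].
have := h a f 0 hf h0; rewrite addr0; congr (_ \in _).
Qed.

Lemma sqint_submod_closed : submod_closed sqint.
Proof.
split.
  have [h0 _] := Lfun_submod_closed mu le12.
  by rewrite inE; apply/andP; split; exact: h0.
move=> a f g /andP[f1 f2] /andP[g1 g2]; rewrite inE; apply/andP; split.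
- rewrite (_ : _ \o _ = ((complex.Re a \*o (@complex.Re R \o f)) \+
     ((- complex.Im a) \*o (@complex.Im R \o f))) \+ (@complex.Re R \o g)).
    by do ?[apply: Lfun2D|apply: Lfun2Z].
  apply/funext => t /=; rewrite !fctE; case: a (f t) (g t) => ? ? [? ?] [? ?] /=.
  by rewrite mulNr.
- rewrite (_ : _ \o _ = ((complex.Re a \*o (@complex.Im R \o f)) \+
     ((complex.Im a) \*o (@complex.Re R \o f))) \+ (@complex.Im R \o g)).
    by do ?[apply: Lfun2D|apply: Lfun2Z].
  by apply/funext => t /=; rewrite !fctE; case: a (f t) (g t) => ? ? [? ?] [? ?] /=.
Qed.

HB.instance Definition _ :=
  GRing.isSubmodClosed.Build C (T -> C) sqint sqint_submod_closed.

Record L2fun := MkL2fun { L2fun_val :> T -> C ; _ : L2fun_val \in sqint }.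
HB.instance Definition _ := [isSub for L2fun_val].
HB.instance Definition _ := gen_eqMixin L2fun.
HB.instance Definition _ := gen_choiceMixin L2fun.
HB.instance Definition _ := [SubChoice_isSubLmodule of L2fun by <:].

Definition L2null : {pred L2fun} :=
  [pred f : L2fun | `[< {ae mu, forall t, f t = 0} >]].


Lemma L2null_submod_closed : submod_closed L2null.
Proof.
split; first by apply/asboolP; exact: aeW.
move=> a f g /asboolP f0 /asboolP g0; apply/asboolP.
move: f0 g0; apply: filterS2 => t ft gt.
by rewrite -[LHS]/(a * f t + g t) ft gt mulr0 addr0.
Qed.

HB.instance Definition _ :=
  GRing.isSubmodClosed.Build C L2fun L2null L2null_submod_closed.

Definition L2 : Type := Quotient.quot L2null.
HB.instance Definition _ := GRing.Zmodule.on L2.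
HB.instance Definition _ := EqQuotient.on L2.

Definition L2class (f : L2fun) : L2 := \pi_L2 f.

Lemma L2classP (f g : L2fun) :
  L2class f = L2class g <-> {ae mu, forall t, f t = g t}.
Proof.
rewrite /L2class; split.
- move/eqP; rewrite -Quotient.idealrBE => /asboolP; apply: filterS => t.
  by move=> h; apply/eqP; rewrite -subr_eq0; apply/eqP.
- move=> h; apply/eqP; rewrite -Quotient.idealrBE; apply/asboolP.
  by move: h; apply: filterS => t h; rewrite -[LHS]/(f t - g t) h subrr.
Qed.

Lemma reprL2 (x : L2) : L2class (repr x) = x.
Proof. exact: reprK. Qed.

Definition L2scale (a : C) (x : L2) : L2 := L2class (a *: (repr x : L2fun)).

Lemma L2class_scale a f : L2scale a (L2class f) = L2class (a *: f).
Proof.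
apply/L2classP; have /L2classP := reprL2 (L2class f).
by apply: filterS => t /(congr1 ( *%R a)).
Qed.

Lemma L2class_add f g : L2class f + L2class g = L2class (f + g).
Proof. exact/esym/Quotient.pi_add. Qed.

Lemma L2ind (P : L2 -> Prop) : (forall f, P (L2class f)) -> forall x, P x.
Proof. by move=> h x; rewrite -(reprL2 x). Qed.

Let L2scaleA a b x : L2scale a (L2scale b x) = L2scale (a * b) x.
Proof. by elim/L2ind: x => f; rewrite !L2class_scale scalerA. Qed.
Let L2scale1 : left_id 1 L2scale.
Proof. by elim/L2ind => f; rewrite L2class_scale scale1r. Qed.
Let L2scaleDr : right_distributive L2scale +%R.
Proof.
move=> a; elim/L2ind => f; elim/L2ind => g.
by rewrite !(L2class_add, L2class_scale) scalerDr.
Qed.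
Let L2scaleDl x : {morph L2scale^~ x : a b / a + b}.
Proof.
by elim/L2ind: x => f a b /=; rewrite !L2class_scale L2class_add scalerDl.
Qed.

HB.instance Definition _ := GRing.Zmodule_isLmodule.Build C L2
  L2scaleA L2scale1 L2scaleDr L2scaleDl.

Definition Cintegral (f : T -> C) : C :=
  Complex (\int[mu]_t complex.Re (f t)) (\int[mu]_t complex.Im (f t)).

Definition L2dot (x y : L2) : C := Cintegral (fun t => repr x t * (repr y t)^* ).


Lemma L2fun_Re (f : L2fun) : (fun t => complex.Re (f t)) \in Lfun mu 2%:E.
Proof. by case: f => f /= /andP[]. Qed.

Lemma L2fun_Im (f : L2fun) : (fun t => complex.Im (f t)) \in Lfun mu 2%:E.
Proof. by case: f => f /= /andP[]. Qed.

Definition Cintegrable (h : T -> C) :=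
  mu.-integrable setT (EFin \o (fun t => complex.Re (h t))) /\
  mu.-integrable setT (EFin \o (fun t => complex.Im (h t))).

Lemma Cintegrable_mulJ (f g : L2fun) : Cintegrable (fun t => f t * (g t)^* ).
Proof.
have mul (u v : T -> R) : u \in Lfun mu 2%:E -> v \in Lfun mu 2%:E ->
    mu.-integrable setT (EFin \o (u \* v)).
  by move=> hu hv; apply/Lfun1_integrable; exact: Lfun2_mul_Lfun1.
have fR := L2fun_Re f; have fI := L2fun_Im f.
have gR := L2fun_Re g; have gI := L2fun_Im g.
split.
- have := integrableD measurableT (mul _ _ fR gR) (mul _ _ fI gI).
  congr (mu.-integrable setT _); apply/funext => t /=.
  by case: (f t) (g t) => ? ? [? ?] /=; rewrite mulrN opprK EFinD.
- have := integrableB measurableT (mul _ _ fI gR) (mul _ _ fR gI).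
  congr (mu.-integrable setT _); apply/funext => t /=.
  by case: (f t) (g t) => ? ? [? ?] /=; rewrite mulrN [X in _ = X%:E]addrC.
Qed.

Lemma CintegralD (h k : T -> C) : Cintegrable h -> Cintegrable k ->
  Cintegral (fun t => h t + k t) = Cintegral h + Cintegral k.
Proof.
move=> [h1 h2] [k1 k2]; rewrite /Cintegral; apply/eqP; rewrite eq_complex/=.
rewrite -!RintegralD//; apply/andP; split; apply/eqP; apply: eq_Rintegral => t _;
  by case: (h t) (k t) => ? ? [].
Qed.

Lemma CintegralZ a (h : T -> C) : Cintegrable h ->
  Cintegral (fun t => a * h t) = a * Cintegral h.
Proof.
move=> [h1 h2]; rewrite /Cintegral; case: a => a b; apply/eqP.
rewrite eq_complex/= -!RintegralZl//.
have iZ c (u : T -> R) : mu.-integrable setT (EFin \o u) ->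
    mu.-integrable setT (EFin \o (fun t => c * u t)).
  by move=> hu; exact: (@integrableZl _ _ _ mu _ measurableT c _ hu).
rewrite -RintegralB ?iZ// -RintegralD ?iZ//.
by apply/andP; split; apply/eqP; apply: eq_Rintegral => t _; case: (h t).
Qed.

Lemma CintegralJ (h : T -> C) :  Cintegrable h ->
  Cintegral (fun t => (h t)^* ) = (Cintegral h)^*.
Proof.
move=> [h1 h2]; rewrite /Cintegral; apply/eqP; rewrite eq_complex/=.
rewrite -mulN1r -RintegralZl//.
apply/andP; split; apply/eqP; apply: eq_Rintegral => t _; case: (h t) => //= *.
by rewrite mulN1r.
Qed.

Lemma Cintegral_ae (h k : T -> C) : Cintegrable h -> Cintegrable k ->
  {ae mu, forall t, h t = k t} -> Cintegral h = Cintegral k.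
Proof.
move=> [/integrableP[h1 _] /integrableP[h2 _]] [/integrableP[k1 _] /integrableP[k2 _]] hk.
congr Complex; congr fine; apply: ae_eq_integral => //;
  by apply: filterS hk => t /= -> _.
Qed.

Lemma L2dotE (f g : L2fun) :
  L2dot (L2class f) (L2class g) = Cintegral (fun t => f t * (g t)^* ).
Proof.
apply: Cintegral_ae; try exact: Cintegrable_mulJ.
have /L2classP := reprL2 (L2class f); have /L2classP := reprL2 (L2class g).
by apply: filterS2 => t -> ->.
Qed.

Let L2dotP a (x y z : L2) : L2dot (a *: x + y) z = a * L2dot x z + L2dot y z.
Proof.
elim/L2ind: x => f; elim/L2ind: y => g; elim/L2ind: z => h.
rewrite [a *: _]L2class_scale L2class_add !L2dotE.
rewrite -CintegralZ -?CintegralD; do ?exact: Cintegrable_mulJ; last first.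
  have := Cintegrable_mulJ (a *: f) h; congr Cintegrable; apply/funext => t.
  by rewrite mulrA.
by congr Cintegral; apply/funext => t; rewrite mulrA -mulrDl.
Qed.

Let L2dotC x y : L2dot x y = (-1) ^+ false * (L2dot y x)^*.
Proof.
elim/L2ind: x => f; elim/L2ind: y => g; rewrite expr0 mul1r !L2dotE.
rewrite -CintegralJ; last exact: Cintegrable_mulJ.
by congr Cintegral; apply/funext => t; rewrite rmorphM/= conjCK mulrC.
Qed.

Let L2dot_bilinear : bilinear_for ( *%R ) (Num.conj \; *%R) L2dot.
Proof.
split=> [z a x y|x a y z]; first exact: L2dotP.
rewrite L2dotC L2dotP !expr0 !mul1r rmorphD rmorphM/=.
by congr (_ * _ + _); rewrite [RHS]L2dotC mul1r.
Qed.

HB.instance Definition _ := @bilinear_isBilinear.Build C L2 L2 C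
  ( *%R ) (Num.conj \; *%R) L2dot L2dot_bilinear.

Let L2dot_gt0 x : x != 0 -> 0 < L2dot x x.
Proof.
elim/L2ind: x => f f0.
have [iR iI] := Cintegrable_mulJ f f.
have ReE t : complex.Re (f t * (f t)^* ) = complex.Re (f t) ^+ 2 + complex.Im (f t) ^+ 2.
  by case: (f t) => ? ? /=; rewrite mulrN opprK !expr2.
have ImE t : complex.Im (f t * (f t)^* ) = 0.
  by case: (f t) => ? ? /=; rewrite mulrN mulrC addNr.
have I0 : \int[mu]_t complex.Im (f t * (f t)^* ) = 0.
  by rewrite /Rintegral; under eq_integral do rewrite ImE; rewrite integral0.
rewrite L2dotE /Cintegral I0 ltcE/= eqxx/= lt_neqAle Rintegral_ge0 ?andbT; last first.
  by move=> t _; rewrite ReE addr_ge0 ?sqr_ge0.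
apply: contra f0 => /eqP/esym R0; apply/eqP.
have R0' : (\int[mu]_t `|(complex.Re (f t * (f t)^* ))%:E| = 0)%E.
  rewrite -[RHS]/(0%:E) -R0 /Rintegral fineK; last first.
    exact: integrable_fin_num.
  apply: eq_integral => t _; rewrite gee0_abs// lee_fin ReE.
  by rewrite addr_ge0 ?sqr_ge0.
have mR := measurable_int _ iR.
have [+ _] := @ae_eq_integral_abs _ _ _ mu _ measurableT _ mR.
move=> /(_ R0') h.
rewrite -[RHS](_ : L2class 0 = 0); last first.
  by apply: (addIr (L2class 0)); rewrite L2class_add !add0r.
apply/L2classP; move: h; apply: filterS => t /= /(_ I) [].
rewrite ReE => /eqP; rewrite paddr_eq0 ?sqr_ge0// !sqrf_eq0 => /andP[/eqP h1 /eqP h2].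
by apply/eqP; rewrite eq_complex h1 h2 !eqxx.
Qed.

HB.instance Definition _ := @isHermitianSesquilinear.Build C L2
  false Num.conj L2dot L2dotC.
HB.instance Definition _ := @isDotProduct.Build C L2 L2dot L2dot_gt0.
End L2.

Section Operators.
Context {R : realType}.
Local Notation C := R[i].

Section OneSpace.
Context {H : lmodType C}.
Variable dot : {dot H for Num.conj}.

Definition hnorm (x : H) : R := Num.sqrt (complex.Re (dot x x)).

Definition hilbert_complete : Prop := forall u : nat -> H,
  (forall e : R, 0 < e -> exists N, forall m n,
     (N <= m)%N -> (N <= n)%N -> hnorm (u m - u n) < e) ->
  exists l, forall e : R, 0 < e -> exists N, forall n,
     (N <= n)%N -> hnorm (u n - l) < e.

Definition bounded_op : set (H -> H) :=
  [set T | linear T /\ exists M : R, forall x, hnorm (T x) <= M * hnorm x].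

Definition commutant (S : set (H -> H)) : set (H -> H) :=
  [set T | bounded_op T /\ forall A, S A -> T \o A = A \o T].

Definition bicommutant (S : set (H -> H)) : set (H -> H) :=
  commutant (commutant S).

(* On a Hilbert space every bounded operator has exactly one adjoint, so the
   default [idfun] plays no role there. *)
Definition adj (T : H -> H) : H -> H :=
  xget (idfun : H -> H) [set S | forall x y, dot (T x) y = dot x (S y)].

(* [<=] on [R[i]] forces the difference of both sides to be real, so [op_le A B]
   says that [B - A] is a positive operator. *)
Definition op_le (A B : H -> H) : Prop := forall x, dot (A x) x <= dot (B x) x.

Definition op_lub (M D : set (H -> H)) (T : H -> H) : Prop :=
  [/\ M T, forall S, D S -> op_le S T
    & forall T', M T' -> (forall S, D S -> op_le S T') -> op_le T T'].

Definition trivial_kernel (T : H -> H) : Prop := forall x, T x = 0 -> x = 0.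

Definition invertible_in (M : set (H -> H)) (a : H -> H) : Prop :=
  M a /\ exists b, [/\ M b, a \o b = idfun & b \o a = idfun].

End OneSpace.

Section TwoSpaces.
Context {H K : lmodType C}.
Variables (hdot : {dot H for Num.conj}) (kdot : {dot K for Num.conj}).

Record star_hom (M : set (H -> H)) (N : set (K -> K))
    (Phi : (H -> H) -> (K -> K)) : Prop := {
  star_hom_img : forall S, M S -> N (Phi S) ;
  star_hom_linear : forall (a : C) S T, M S -> M T ->
    Phi (a *: S + T) = a *: Phi S + Phi T ;
  star_hom_comp : forall S T, M S -> M T -> Phi (S \o T) = Phi S \o Phi T ;
  star_hom_adj : forall S, M S -> Phi (adj hdot S) = adj kdot (Phi S)
}.

(* Normality in the sense of Dixmier: suprema of increasingly directed bounded
   families of self-adjoint elements are preserved. *)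
Definition normal_map (M : set (H -> H)) (N : set (K -> K))
    (Phi : (H -> H) -> (K -> K)) : Prop :=
  forall (D : set (H -> H)) (T : H -> H),
    D !=set0 ->
    (forall S, D S -> M S /\ adj hdot S = S) ->
    (forall S S', D S -> D S' ->
       exists S'', [/\ D S'', op_le hdot S S'' & op_le hdot S' S'']) ->
    op_lub hdot M D T -> op_lub kdot N (Phi @` D) (Phi T).

(* [K], with the map [tens], is the Hilbert space tensor square of [H]; this
   determines [(K, tens)] up to a unique unitary. *)
Record hilbert_tensor (tens : {bilinear H -> H -> K}) : Prop := {
  tensor_complete : hilbert_complete kdot ;
  tensor_dot : forall a b a' b',
    kdot (tens a b) (tens a' b') = hdot a a' * hdot b b' ;
  tensor_dense : forall (k : K) (e : R), 0 < e ->
    exists n (a b : 'I_n -> H),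
      hnorm kdot (k - \sum_(i < n) tens (a i) (b i)) < e
}.

(* The bounded extension of S (x) T from elementary tensors; it exists and is
   unique for bounded S and T as soon as [hilbert_tensor] holds. *)
Definition tensor_op (tens : H -> H -> K) (S T : H -> H) : K -> K :=
  xget (idfun : K -> K) [set U | bounded_op kdot U /\
                      forall a b, U (tens a b) = tens (S a) (T b)].

Definition vn_tensor (tens : H -> H -> K) (M : set (H -> H)) : set (K -> K) :=
  bicommutant kdot [set tensor_op tens S T | S in M & T in M].

End TwoSpaces.
End Operators.

HB.mixin Record isTopologicalGroup G of Topological G & Group G := {
  mulg_continuous : continuous (fun x : G * G => (x.1 * x.2)%g) ;
  invg_continuous : continuous (fun x : G => (x^-1)%g)
}.

#[short(type="topologicalGroupType")]
HB.structure Definition TopologicalGroup :=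
  {G of Topological G & Group G & isTopologicalGroup G}.

Definition locally_compact_group (G : topologicalGroupType) : Prop :=
  hausdorff_space G /\ locally_compact [set: G].

Definition borel (G : topologicalGroupType) : Type := G.

Section Borel.
Variable G : topologicalGroupType.

HB.instance Definition _ := Choice.on (borel G).
HB.instance Definition _ := isPointed.Build (borel G) (1%g : G).
HB.instance Definition _ := @isMeasurable.Build
  (sigma_display (@open G)) (borel G) <<s @open G >>
  (@sigma_algebra0 _ setT (@open G)) (@sigma_algebraC (borel G) (@open G))
  (@sigma_algebra_bigcup _ setT (@open G)).

End Borel.

(* A nonzero left-invariant Radon measure on the Borel sigma-algebra of [G]. *)
Record left_haar (G : topologicalGroupType) (R : realType)
    (mu : {measure set (borel G) -> \bar R}) : Prop := {
  haar_invariant : forall (s : G) (A : set (borel G)), measurable A ->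
    mu [set (s * t)%g | t in A] = mu A ;
  haar_compact : forall K : set G, compact K -> (mu K < +oo)%E ;
  haar_outer : forall A : set (borel G), measurable A ->
    mu A = ereal_inf [set mu U | U in [set U : set G | open U /\ A `<=` U]] ;
  haar_inner : forall U : set G, open U ->
    mu U = ereal_sup [set mu K | K in [set K : set G | compact K /\ K `<=` U]] ;
  haar_neq0 : mu [set: G] <> 0%E
}.

Section FourierAlgebra.
Context {G : topologicalGroupType} {R : realType}.
Variable mu : {measure set (borel G) -> \bar R}.
Local Notation C := R[i].
Local Notation L2G := (L2 mu).
Local Notation dotG := (@L2dot _ _ _ mu : {dot L2G for Num.conj}).

Definition translate (s : G) (f : G -> C) : G -> C := fun t => f (s^-1 * t)%g.

Let phi (s : G) (t : borel G) : borel G := (s^-1 * t)%g.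

Let measurable_phi s : measurable_fun setT (phi s).
Proof.
have phi_cont : continuous (fun t : G => (s^-1 * t)%g).
  move=> t; have h := @mulg_continuous G ((s^-1)%g, t).
  have k : (fun t : G => ((s^-1)%g, t)) u @[u --> t] --> ((s^-1)%g, t).
    by apply: cvg_pair; [exact: cvg_cst|exact: cvg_id].
  exact: (@cvg_comp _ _ _ _ _ _ _ _ k h).
apply: (@measurability _ _ _ _ setT (phi s) (@open G)) => //.
move=> _ [U oU <-]; rewrite setTI; apply: sub_sigma_algebra.
by move/continuousP: phi_cont; exact.
Qed.

Let mu_phi (hmu : left_haar mu) s A :
  measurable A -> pushforward mu (phi s) A = mu A.
Proof.
move=> mA; rewrite -[RHS](haar_invariant hmu s mA); congr (mu _).
apply/seteqP; split => [t At|_ [t At <-]].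
  by exists (phi s t) => //; rewrite /phi mulgA mulgV mul1g.
by rewrite /= /phi mulgA mulVg mul1g.
Qed.

Let integral_phi (hmu : left_haar mu) s (f : borel G -> \bar R) :
  measurable_fun setT f -> (forall x, 0 <= f x)%E ->
  (\int[mu]_x f (phi s x) = \int[mu]_x f x)%E.
Proof.
move=> mf f0.
have := ge0_integral_pushforward (measurable_phi s) mu measurableT mf.
rewrite preimage_setT => <-; last by move=> y _; exact: f0.
by apply: eq_measure_integral => A mA _; exact: (mu_phi hmu s mA).
Qed.

Lemma translate_sqint (hmu : left_haar mu) s (f : G -> C) :
  f \in sqint mu -> translate s f \in sqint mu.
Proof.
have L g : g \in Lfun mu 2%:E -> g \o phi s \in Lfun mu 2%:E.
  case/andP; rewrite !inE /= => mg g2; apply/andP; split.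
    by rewrite inE/=; exact: measurableT_comp (measurable_phi s).
  rewrite inE/=; move: g2; rewrite /finite_norm unlock /Lnorm.
  set I1 := (\int[mu]_x _)%E; set I2 := (\int[mu]_x _)%E.
  suff -> : I2 = I1 by [].
  apply: (integral_phi hmu s (f := fun x => (`|(g x)%:E| `^ 2)%E)); last first.
    by move=> x; exact: poweR_ge0.
  rewrite [X in measurable_fun _ X](_ : _ = EFin \o (fun x => `|g x| `^ 2))//.
  apply/measurable_EFinP.
  apply: (measurableT_comp (measurable_powR _)) => //.
  exact: measurableT_comp.
by case/andP => fR fI; apply/andP; split; [exact: L fR|exact: L fI].
Qed.

(* The translate of a representative; when [mu] is a Haar measure the default
   of [insubd] is never used ([translate_sqint]) and the class does not depend
   on the representative ([lambdaE]). *)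
Definition lambda (s : G) (x : L2G) : L2G :=
  L2class (insubd (0 : L2fun mu) (translate s (repr x : L2fun mu))).

Lemma lambdaE (hmu : left_haar mu) s (f g : L2fun mu) :
  {ae mu, forall t, g t = translate s f t} -> lambda s (L2class f) = L2class g.
Proof.
move=> gf; apply/L2classP.
set h := translate s _; set k := insubd _ _.
have kE : k = h :> (G -> C).
  have hh : h \in sqint mu by apply: (translate_sqint hmu); exact: valP.
  exact: (insubdK (0 : L2fun mu) hh).
have /L2classP [N [mN N0 fN]] := reprL2 (L2class f).
have fN' : {ae mu, forall t, translate s (repr (L2class f) : L2fun mu) t =
                             translate s f t}.
  exists (phi s @^-1` N); split.
  - by rewrite -[X in measurable X]setTI; exact: measurable_phi.
  - exact: etrans (mu_phi hmu s mN) N0.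
  - by move=> t /= tN; exact: fN.
rewrite kE; apply: (@filterS2 _ _ (ae_filter_ringOfSetsType mu) _ _ _ _ fN' gf).
by move=> t e1 e2; exact: etrans e1 (esym e2).
Qed.

Definition VN : set (L2G -> L2G) := bicommutant dotG (range lambda).

Definition coef (xi eta : L2G) : G -> C := fun s => dotG (lambda s xi) eta.

Definition fourier_algebra : set (G -> C) :=
  [set u | exists xi eta, u = coef xi eta].

(* (T, u) = <T xi, eta> whenever u = <lambda(.) xi, eta>: for T in VN(G) the value
   is independent of (xi, eta), T being in the weak closure of the span of
   lambda(G). *)
Definition pairing (T : L2G -> L2G) (u : G -> C) : C :=
  xget 0 [set z | exists xi eta, u = coef xi eta /\ z = dotG (T xi) eta].

(* T f is the g in A(G) with (S, g) = (S T, f) for all S in VN(G); for T in VN(G)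
   and f = <lambda(.) xi, eta> it is <lambda(.) T xi, eta>. *)
Definition vn_act (T : L2G -> L2G) (f : G -> C) : G -> C :=
  xget 0 [set g | fourier_algebra g /\
                  forall S, VN S -> pairing S g = pairing (S \o T) f].

Definition weighted_fourier (omega : L2G -> L2G) : set (G -> C) :=
  [set vn_act omega f | f in fourier_algebra].

Section Comultiplication.
Context {K : lmodType C}.
Variables (kdot : {dot K for Num.conj}) (tens : L2G -> L2G -> K).

Record comultiplication (Gamma : (L2G -> L2G) -> (K -> K)) : Prop := {
  comult_hom : star_hom dotG kdot VN (vn_tensor kdot tens VN) Gamma ;
  comult_normal : normal_map dotG kdot VN (vn_tensor kdot tens VN) Gamma ;
  comult_lambda : forall s,
    Gamma (lambda s) = tensor_op kdot tens (lambda s) (lambda s)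
}.

Record weight_inverse (Gamma : (L2G -> L2G) -> (K -> K))
    (omega : L2G -> L2G) : Prop := {
  winv_VN : VN omega ;
  winv_le : let p := omega \o adj dotG omega in
    op_le kdot (tensor_op kdot tens p p) (Gamma p) ;
  winv_ker : trivial_kernel omega ;
  winv_ker_adj : trivial_kernel (adj dotG omega)
}.

End Comultiplication.
End FourierAlgebra.

Arguments L2dot {d T R} mu.
Arguments lambda {G R} mu.
Arguments VN {G R} mu.
Arguments coef {G R} mu.
Arguments fourier_algebra {G R} mu.
Arguments pairing {G R} mu.
Arguments vn_act {G R} mu.
Arguments weighted_fourier {G R} mu.
Arguments comultiplication {G R} mu {K}.
Arguments weight_inverse {G R} mu {K}.

(* Main.v *)
Require Import Defs.
From HB Require Import structures.
From mathcomp Require Import all_boot all_order all_algebra.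
From mathcomp Require Import all_classical all_reals all_analysis.
From mathcomp Require Import measurable_realfun complex ring lra.

Set Implicit Arguments.
Unset Strict Implicit.
Unset Printing Implicit Defensive.

Import Order.TTheory GRing.Theory Num.Theory.
Import numFieldNormedType.Exports.

Local Open Scope classical_set_scope.
Local Open Scope ring_scope.

(** An element of A(G) is a coefficient [coef xi eta], and [omega] acts on it
    by [coef xi eta |-> coef (omega xi) eta] ([vn_act_coef]).  This is well
    defined because a coefficient determines the functional
    [T |-> <T xi, eta>] on all of VN(G): two such functionals that agree on
    the left translations agree on their bicommutant
    ([bicommutant_functional]).  The inclusion of the weighted Fourier
    algebras therefore says that for all vectors [x], [y] there are [x'],
    [y'] such that [<T omega1 x, y> = <T omega2 x', y'>] for every [T] in
    VN(G).  The rest is a statement about two injective operators with dense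
    range in a von Neumann algebra ([bicommutant_factor]), proved with Hilbert
    space arguments only, without putting a norm on A(G).

    The right-hand side is at most [|x'| |y'|] as soon as
    [|T omega2 z| <= |z|] for all [z].  So the operators [T omega1], over all
    [T] in VN(G) with that property, are pointwise weakly bounded, and two
    applications of the uniform boundedness principle give one constant [C]
    with [|T omega1 z| <= C |z|] ([uniform_domination]).

    This is applied to the regularized inverses of [omega2],
    [T_e = (omega2* omega2 + e^2)^-1 omega2*].  They belong to VN(G), and
    [T_e omega2] is a contraction, hence [z_e = T_e (omega1 x)] stays bounded
    by [C |x|] as [e] tends to 0.  The squared norms [|z_e|^2] increase as [e]
    decreases, by at least the squared distance between the [z_e]; being
    bounded, the [z_e] converge in norm.  Their limit [z] satisfies
    [omega2 z = omega1 x], because [omega1 x - omega2 z] is orthogonal to the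
    dense range of [omega2] ([tikhonov_limit]).  Since [omega2] is injective,
    [z] is a function [a x] of [x]; [a] is bounded by [C], and it is linear
    and commutes with the commutant of VN(G), again by injectivity.

    If the two weighted algebras coincide, the factors [a] and [b] obtained in
    the two directions are inverse to each other, [omega1] and [omega2] being
    injective.  Conversely [coef (omega2 (a xi)) eta] visibly lies in the
    weighted algebra of [omega2], and the inverse of [a] gives the other
    inclusion.

    The Hilbert space facts used on the way, from the orthogonal projection to
    the completeness of L2, are developed first. *)

(** * Real inner products and orthogonal projection *)

Section Hilbert.
Context {R : realType} {H : lmodType R[i]}.
Variable dot : {dot H for Num.conj}.
Implicit Types (x y z v w : H) (r : R) (u : nat -> H).

(** The Hilbert space arguments below are run on the real inner product:
    it is symmetric and bilinear over the reals, and it determines the complex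
    one (see [dotE]). *)
Definition rdot x y : R := complex.Re (dot x y).
Local Notation "'[ x , y ]" := (rdot x y).
Local Notation norm := (hnorm dot).

Lemma rdotC x y : '[x, y] = '[y, x].
Proof.
rewrite /rdot hermC/= expr0 mul1r; case: (dot y x) => a b; reflexivity.
Qed.

Lemma rdotDl x y z : '[x + y, z] = '[x, z] + '[y, z].
Proof. by rewrite /rdot linearDl raddfD. Qed.

Lemma rdotNl x z : '[- x, z] = - '[x, z].
Proof. by rewrite /rdot linearNl raddfN. Qed.

Lemma rdotBl x y z : '[x - y, z] = '[x, z] - '[y, z].
Proof. by rewrite rdotDl rdotNl. Qed.

Lemma rdotZl r x z : '[r%:C%C *: x, z] = r * '[x, z].
Proof.
by rewrite /rdot linearZl_LR/=; case: (dot x z) => a b /=; rewrite mul0r subr0.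
Qed.

Lemma rdotDr x y z : '[z, x + y] = '[z, x] + '[z, y].
Proof. by rewrite !(rdotC z) rdotDl. Qed.

Lemma rdotNr x z : '[z, - x] = - '[z, x].
Proof. by rewrite !(rdotC z) rdotNl. Qed.

Lemma rdotBr x y z : '[z, x - y] = '[z, x] - '[z, y].
Proof. by rewrite !(rdotC z) rdotBl. Qed.

Lemma rdotZr r x z : '[z, r%:C%C *: x] = r * '[z, x].
Proof. by rewrite !(rdotC z) rdotZl. Qed.

Lemma rdot0l x : '[0, x] = 0.
Proof. by rewrite /rdot linear0l. Qed.

Lemma rdot0r x : '[x, 0] = 0.
Proof. by rewrite rdotC rdot0l. Qed.

Lemma dotE x y : dot x y = ('[x, y] +i* '[x, 'i%C *: y])%C.
Proof.
rewrite /rdot linearZr_LR/=; case: (dot x y) => a b /=; congr Complex.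
by rewrite !mul0r mulN1r opprK add0r.
Qed.

Lemma dot_rdot x y x' y' : (forall c : R[i], '[x, c *: y] = '[x', c *: y']) ->
  dot x y = dot x' y'.
Proof. by move=> h; rewrite !dotE h -[y]scale1r h scale1r. Qed.

Lemma rdot_ge0 x : 0 <= '[x, x].
Proof.
by have := dnorm_ge0 dot x; rewrite lecE /rdot => /andP[].
Qed.

Lemma hnormE x : norm x ^+ 2 = '[x, x].
Proof. by rewrite sqr_sqrtr// rdot_ge0. Qed.

Lemma hnorm_ge0 x : 0 <= norm x.
Proof. exact: sqrtr_ge0. Qed.

Lemma hnorm0 : norm 0 = 0.
Proof. by rewrite /hnorm linear0l sqrtr0. Qed.

Lemma hnorm0_eq0 x : norm x = 0 -> x = 0.
Proof.
move=> x0; apply/eqP; rewrite -(dnorm_eq0 dot) dotE -hnormE x0 eq_complex/=.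
by rewrite expr0n/= eqxx rdotC /rdot linearZl_LR/=; case: (dot x x) (dnorm_ge0 dot x)
  => a b; rewrite lecE/= => /andP[/eqP-> _]; rewrite mul0r mul1r subrr.
Qed.

Lemma rdot_inj x y : (forall z, '[x, z] = '[y, z]) -> x = y.
Proof.
move=> h; apply/eqP; rewrite -subr_eq0; apply/eqP/hnorm0_eq0.
by apply/eqP; rewrite -sqrf_eq0 hnormE rdotBl h subrr.
Qed.

Lemma hnorm_opp x : norm (- x) = norm x.
Proof. by rewrite /hnorm linearNl linearNr opprK. Qed.

Lemma hnorm_distC x y : norm (x - y) = norm (y - x).
Proof. by rewrite -hnorm_opp opprB. Qed.

Lemma hnormZ r x : norm (r%:C%C *: x) = `|r| * norm x.
Proof.
apply/eqP; rewrite -(@eqrXn2 _ 2)// ?mulr_ge0 ?hnorm_ge0//.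
by rewrite exprMn !hnormE rdotZl rdotZr mulrA -expr2 real_normK// num_real.
Qed.

(** Expand [0 <= | |y| x - |x| y |^2]. *)
Lemma cauchy_schwarz x y : '[x, y] <= norm x * norm y.
Proof.
have := rdot_ge0 ((norm y)%:C%C *: x - (norm x)%:C%C *: y).
rewrite !(rdotBl, rdotBr, rdotZl, rdotZr) -!hnormE (rdotC y x).
have [y0|y0] := eqVneq (norm y) 0.
  by move=> _; rewrite (hnorm0_eq0 y0) rdot0r hnorm0 mulr0.
have [x0|x0] := eqVneq (norm x) 0.
  by move=> _; rewrite (hnorm0_eq0 x0) rdot0l hnorm0 mul0r.
move=> h; have xy0 : 0 < norm x * norm y.
  by rewrite mulr_gt0// lt_neqAle eq_sym ?x0 ?y0 hnorm_ge0.
by rewrite -(@ler_pM2l _ (norm x * norm y))//; nra.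
Qed.

Lemma cauchy_schwarz_abs x y : `|'[x, y]| <= norm x * norm y.
Proof.
by rewrite ler_norml cauchy_schwarz andbT lerNl -rdotNl -(hnorm_opp x) cauchy_schwarz.
Qed.

Lemma ler_hnormD x y : norm (x + y) <= norm x + norm y.
Proof.
rewrite -(@ler_pXn2r _ 2) ?nnegrE ?addr_ge0 ?hnorm_ge0//.
rewrite hnormE rdotDl !rdotDr -!hnormE (rdotC y x).
have := cauchy_schwarz x y; nra.
Qed.

Lemma ler_hnorm_tri z x y : norm (x - y) <= norm (x - z) + norm (z - y).
Proof. by rewrite (le_trans _ (ler_hnormD _ _))// addrA subrK. Qed.

Definition hcvg u x := hnorm dot (u n - x) @[n --> \oo] --> (0 : R).

Lemma hcvgP u x : hcvg u x <->
  forall e : R, 0 < e -> exists N, forall n, (N <= n)%N -> norm (u n - x) < e.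
Proof.
split.
- move=> /cvgrPdist_lt h e /h [N _ hN]; exists N => n /hN /=.
  by rewrite sub0r normrN ger0_norm// hnorm_ge0.
- move=> h; apply/cvgrPdist_lt => e /h [N hN]; exists N => // n /= /hN.
  by rewrite sub0r normrN ger0_norm// hnorm_ge0.
Qed.


Lemma cvg_bounded_dist (a b : nat -> R) l :
  (forall n, `|a n - l| <= b n) -> b n @[n --> \oo] --> (0 : R) ->
  a n @[n --> \oo] --> l.
Proof.
move=> ab /cvgrPdist_lt b0; apply/cvgrPdist_lt => e /b0; apply: filterS => n /=.
rewrite sub0r normrN distrC => bn; apply: le_lt_trans (ab n) _.
exact: le_lt_trans (ler_norm _) bn.
Qed.

Lemma seq_limit_unique (a : nat -> R) (l l' : R) :
  a @ \oo --> l -> a @ \oo --> l' -> l = l'.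
Proof. by move=> al al'; rewrite -(cvg_lim _ al)// -(cvg_lim _ al'). Qed.

Lemma hcvg_bounded_dist u x (b : nat -> R) :
  (forall n, norm (u n - x) <= b n) -> b n @[n --> \oo] --> (0 : R) ->
  hcvg u x.
Proof.
move=> ub; apply: cvg_bounded_dist => n.
by rewrite subr0 ger0_norm// hnorm_ge0.
Qed.

Lemma hcvg_rdot u x y : hcvg u x -> '[u n, y] @[n --> \oo] --> '[x, y].
Proof.
move=> ux; apply: (@cvg_bounded_dist _ (fun n => norm (u n - x) * norm y)).
  by move=> n; rewrite -rdotBl cauchy_schwarz_abs.
by rewrite -[X in _ --> X](mul0r (norm y)); apply: cvgMr_tmp.
Qed.

Lemma hcvg_unique u x y : hcvg u x -> hcvg u y -> x = y.
Proof.
move=> ux uy; apply: rdot_inj => z.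
by apply: (@seq_limit_unique (fun n => '[u n, z])); exact: hcvg_rdot.
Qed.

Lemma hcvg_norm u x : hcvg u x -> norm (u n) @[n --> \oo] --> norm x.
Proof.
apply: cvg_bounded_dist => n; rewrite ler_norml.
have := ler_hnormD (u n - x) x; have := ler_hnormD (x - u n) (u n).
by rewrite !subrK (hnorm_distC x); lra.
Qed.

Lemma hcvg_lip (T : H -> H) (M : R) u x :
  (forall n, norm (T (u n) - T x) <= M * norm (u n - x)) -> hcvg u x ->
  hcvg (T \o u) (T x).
Proof.
move=> TM ux; apply: (hcvg_bounded_dist TM).
by rewrite -[X in _ --> X](mulr0 M); apply: cvgMl_tmp.
Qed.

Lemma bounded_opB (T : H -> H) x y : bounded_op dot T -> T (x - y) = T x - T y.
Proof.
move=> [lT _]; have := lT (- 1) y x.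
by rewrite !scaleN1r ![- _ + _]addrC.
Qed.

Lemma bounded_op_bound (T : H -> H) : bounded_op dot T ->
  exists2 M : R, 0 < M & forall x, norm (T x) <= M * norm x.
Proof.
move=> [_ [M TM]]; exists (`|M| + 1); first by rewrite ltr_wpDl.
move=> x; apply: (le_trans (TM x)); rewrite ler_wpM2r ?hnorm_ge0//.
by rewrite (le_trans (ler_norm _))// lerDl.
Qed.

Lemma hcvg_op (T : H -> H) u x : bounded_op dot T -> hcvg u x ->
  hcvg (T \o u) (T x).
Proof.
move=> bT; have [_ [M TM]] := bT; apply: hcvg_lip => n.
by rewrite -bounded_opB.
Qed.

(** The form of completeness used for sequences with a one-sided explicit
    modulus, which is what estimates for [m <= n] provide. *)
Lemma complete_cvg u (c : nat -> R) : hilbert_complete dot ->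
  (forall m n, (m <= n)%N -> norm (u m - u n) <= c m) ->
  c n @[n --> \oo] --> (0 : R) -> exists x, hcvg u x.
Proof.
move=> hC uc /cvgrPdist_lt c0.
suff : exists l, forall e : R, 0 < e -> exists N, forall n,
     (N <= n)%N -> norm (u n - l) < e by move=> [l ul]; exists l; apply/hcvgP.
apply: hC => e e0; have [|N _ hN] := c0 (e / 2); first by rewrite divr_gt0.
exists N => m n Nm Nn; apply: (le_lt_trans (ler_hnorm_tri (u N) _ _)).
have := hN N (leqnn N); rewrite /= sub0r normrN => /(le_lt_trans (ler_norm _)).
rewrite (hnorm_distC (u m)); have := uc _ _ Nm; have := uc _ _ Nn; lra.
Qed.

(** A minimizing sequence for the distance from [x] to [N] is Cauchy by the
    parallelogram law.  Orthogonality is then obtained by comparing the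
    distance to [v n] with the distance to [v n + r w] and letting [n] grow. *)
Lemma orthogonal_projection (N : set H) x : hilbert_complete dot ->
  N 0 -> (forall v w r, N v -> N w -> N (v + r%:C%C *: w)) ->
  (forall u v, (forall n, N (u n)) -> hcvg u v -> N v) ->
  exists2 p, N p & forall v, N v -> '[x - p, v] = 0.
Proof.
move=> hC N0 NP Ncl.
pose D := [set norm (x - v) ^+ 2 | v in N].
have D0 : has_inf D.
  split; first by exists (norm (x - 0) ^+ 2); exists 0.
  by exists 0 => _ [v _ <-]; exact: sqr_ge0.
have infD v : N v -> inf D <= norm (x - v) ^+ 2.
  by move=> Nv; apply: ge_inf; [exact: D0.2|exists v].
pose h n : R := n.+1%:R^-1.
have h0 n : 0 < h n by rewrite invr_gt0.
have hcv : h n @[n --> \oo] --> (0 : R) by exact: cvg_harmonic.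
have vn n : exists v, N v /\ norm (x - v) ^+ 2 < inf D + h n ^+ 2.
  have [|_ [v Nv <-] hv] := @inf_adherent _ D (h n ^+ 2) _ D0.
    by rewrite exprn_gt0.
  by exists v.
have [v vP] := choice vn.
have [p vp] : exists p, hcvg v p.
  apply: (@complete_cvg v (fun n => 2 * h n)) => //; last first.
    by rewrite -[X in _ --> X](mulr0 2); apply: cvgMl_tmp.
  (* The midpoint of [v m] and [v n] is in [N], hence at least as far from
     [x] as the infimum: the parallelogram law bounds the distance. *)
  move=> m n mn; rewrite -(@ler_pXn2r _ 2) ?nnegrE ?hnorm_ge0 ?mulr_ge0 ?(ltW (h0 _))//.
  have hmn : h n <= h m by rewrite lef_pV2 ?posrE// ler_nat.
  have : N ((1 / 2)%:C%C *: v m + (1 / 2)%:C%C *: v n).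
    rewrite -[X in X + _]add0r; apply: (NP); last exact: (vP _).1.
    by apply: NP => //; exact: (vP _).1.
  move/infD.
  have -> : x - ((1 / 2)%:C%C *: v m + (1 / 2)%:C%C *: v n) =
      (1 / 2)%:C%C *: ((x - v m) + (x - v n)).
    rewrite !scalerDr !scalerN addrACA -opprD; congr (_ - _).
    rewrite -scalerDl -rmorphD/=.
    by rewrite (_ : 1 / 2 + 1 / 2 = 1 :> R) ?scale1r//; lra.
  rewrite hnormZ exprMn real_normK ?num_real//.
  have -> : v m - v n = (x - v n) - (x - v m).
    by rewrite opprB [RHS]addrC addrA subrK.
  have := (vP m).2; have := (vP n).2.
  move: (x - v m) (x - v n) => a b; rewrite !hnormE.
  rewrite !(rdotDl, rdotDr, rdotNl, rdotNr) (rdotC b a) => ha hb hab.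
  by have := h0 n; have := h0 m; nra.
exists p; first by apply: Ncl vp => n; exact: (vP _).1.
move=> w Nw; pose s := '[x - p, w]; pose q := norm w ^+ 2.
have q0 : 0 <= q by exact: sqr_ge0.
have key r : 2 * r * s <= r ^+ 2 * q.
  have c1 : 2 * r * '[x - v n, w] @[n --> \oo] --> 2 * r * s.
    apply: cvgMl_tmp; rewrite /s rdotBl.
    under eq_fun do rewrite rdotBl.
    by apply: cvgB; [exact: cvg_cst|exact: hcvg_rdot].
  have c2 : r ^+ 2 * q + h n ^+ 2 @[n --> \oo] --> r ^+ 2 * q.
    rewrite -[X in _ --> X]addr0; apply: cvgD; first exact: cvg_cst.
    by rewrite -[X in _ --> X](mulr0 0); apply: cvgM.
  apply: ler_cvg_to c1 c2 _; apply: nearW => n.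
  have [Nv hv] := vP n; have := infD _ (NP _ _ r Nv Nw).
  rewrite opprD addrA; move: hv; rewrite /q.
  move: (x - v n) => a; rewrite !hnormE.
  by rewrite !(rdotBl, rdotBr, rdotZl, rdotZr) (rdotC w a); lra.
(* Near its minimum in [r] the bound [key] forces [s = 0]; [q + 1] replaces
   [q] in the minimizer [s / q], as [w] may vanish. *)
have := key (s / (q + 1)).
have q1 : 0 < q + 1 by lra.
rewrite -(@ler_pM2l _ ((q + 1) ^+ 2)) ?exprn_gt0//.
have -> : (q + 1) ^+ 2 * (2 * (s / (q + 1)) * s) = 2 * s ^+ 2 * (q + 1).
  by field; rewrite gt_eqF.
have -> : (q + 1) ^+ 2 * ((s / (q + 1)) ^+ 2 * q) = s ^+ 2 * q.
  by field; rewrite gt_eqF.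
move=> hs; apply/eqP; rewrite -/s -sqrf_eq0 eq_le sqr_ge0 andbT.
by have := sqr_ge0 s; nra.
Qed.

(** If [x0] is not in the kernel of [f], its component orthogonal to the
    kernel spans the orthogonal of the kernel, and a multiple of it represents
    [f]. *)
Lemma riesz_representation (f : H -> R) (M : R) : hilbert_complete dot ->
  (forall x y, f (x + y) = f x + f y) -> (forall r x, f (r%:C%C *: x) = r * f x) ->
  (forall x, `|f x| <= M * norm x) -> exists z, forall x, f x = '[x, z].
Proof.
move=> hC fD fZ fM.
have fN x : f (- x) = - f x.
  by rewrite -scaleN1r (_ : -1 = (-1)%:C%C) ?fZ ?mulN1r// rmorphN.
have [[x0 fx0]|] := pselect (exists x, f x != 0); last first.
  move=> /forallNP f0; exists 0 => x; rewrite rdot0r.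
  by apply/eqP; apply/negP => /negP; exact: f0.
have [|v w r /= v0 w0||p p0 pP] := @orthogonal_projection [set x | f x = 0] x0 hC.
- by rewrite /= -(scale0r 0) fZ mul0r.
- by rewrite /= fD fZ v0 w0 mulr0 addr0.
- move=> u v u0 uv /=.
  have : f (u n) @[n --> \oo] --> f v.
    apply: (@cvg_bounded_dist _ (fun n => M * norm (u n - v))).
      by move=> n; rewrite -fN -fD.
    by rewrite -[X in _ --> X](mulr0 M); apply: cvgMl_tmp.
  rewrite (_ : (fun n => f (u n)) = cst 0); last by apply/funext => n; rewrite u0.
  by move=> /seq_limit_unique; apply => //; exact: cvg_cst.
set w := x0 - p in pP; have fw : f w != 0 by rewrite fD fN p0 subr0.
have w0 : '[w, w] != 0.
  rewrite -hnormE sqrf_eq0; apply: contra fw => /eqP/hnorm0_eq0 ->.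
  by rewrite -(scale0r 0) fZ mul0r.
exists ((f w / '[w, w])%:C%C *: w) => x.
have := pP (x - (f x / f w)%:C%C *: w); rewrite /= fD fN fZ divfK// subrr.
move=> /(_ erefl)/eqP; rewrite rdotBr rdotZr subr_eq0 rdotZr (rdotC x) => /eqP ->.
by field; rewrite fw w0.
Qed.

End Hilbert.

(** * Adjoints *)

Section Adjoint.
Context {R : realType} {H : lmodType R[i]}.
Variable dot : {dot H for Num.conj}.
Hypothesis hC : hilbert_complete dot.
Implicit Types (x y z : H) (T : H -> H).

Local Notation "'[ x , y ]" := (rdot dot x y).
Local Notation norm := (hnorm dot).

Lemma rdot_conj (c : R[i]) x y : '[x, c *: y] = '[(c^*)%C *: x, y].
Proof. rewrite /rdot linearZr_LR linearZl_LR; reflexivity. Qed.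

Lemma rdot_conjl (c : R[i]) x y : '[c *: x, y] = '[x, (c^*)%C *: y].
Proof. by rewrite rdot_conj conjcK. Qed.

Lemma bounded_op0 T : bounded_op dot T -> T 0 = 0.
Proof. by move=> bT; have := bounded_opB 0 0 bT; rewrite !subrr. Qed.

Lemma bounded_opZ T c x : bounded_op dot T -> T (c *: x) = c *: T x.
Proof.
move=> bT; have [lT _] := bT.
have T0 := bounded_op0 bT.
by have := lT c x 0; rewrite T0 !addr0.
Qed.

Lemma bounded_opD T x y : bounded_op dot T -> T (x + y) = T x + T y.
Proof. by move=> [lT _]; have := lT 1 x y; rewrite !scale1r. Qed.

(** [adj] picks some formal adjoint; the representation theorem applied to
    [x |-> <T x, y>] shows that there is one. *)
Lemma adjP T x y : bounded_op dot T -> dot (T x) y = dot x (adj dot T y).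
Proof.
move=> bT; suff /choice[S hS] : forall y, exists z, forall x, dot (T x) y = dot x z.
  have : [set S | forall x y, dot (T x) y = dot x (S y)] S by move=> x' y'.
  by move=> hS'; rewrite /adj; case: xgetP => [S' -> -> //|/(_ S)].
move=> {x y} y; have [M M0 TM] := bounded_op_bound bT.
have [|r x|x|z hz] := @riesz_representation _ _ dot (fun x => '[T x, y]) (M * norm y) hC.
- by move=> x1 x2; rewrite bounded_opD// rdotDl.
- by rewrite bounded_opZ// rdotZl.
- rewrite (le_trans (cauchy_schwarz_abs _ _ _))// mulrAC ler_wpM2r ?hnorm_ge0//.
exists z => x; apply: dot_rdot => c.
by rewrite !rdot_conj -bounded_opZ.
Qed.

Lemma adjE T x y : bounded_op dot T -> '[T x, y] = '[x, adj dot T y].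
Proof. by move=> bT; rewrite /rdot adjP. Qed.

Lemma adjEl T x y : bounded_op dot T -> '[adj dot T x, y] = '[x, T y].
Proof. by move=> bT; rewrite rdotC -adjE// rdotC. Qed.

Lemma adj_bounded T : bounded_op dot T -> bounded_op dot (adj dot T).
Proof.
move=> bT; split.
  move=> c x y; apply: (@rdot_inj _ _ dot) => z.
  rewrite adjEl// !rdotDl adjEl//; congr (_ + _).
  by rewrite !rdot_conjl -bounded_opZ// adjEl.
have [M M0 TM] := bounded_op_bound bT; exists M => x.
have := hnorm_ge0 dot (adj dot T x); rewrite le_eqVlt => /orP[/eqP <-|n0].
  by rewrite mulr_ge0 ?hnorm_ge0 ?ltW.
rewrite -(@ler_pM2l _ (norm (adj dot T x)))// -expr2 hnormE adjEl//.
apply: (le_trans (cauchy_schwarz _ _ _)).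
by have := TM (adj dot T x); have := hnorm_ge0 dot x; nra.
Qed.

End Adjoint.

(** * Uniform boundedness *)

Section UniformBoundedness.
Context {R : realType} {H : lmodType R[i]}.
Variable dot : {dot H for Num.conj}.
Hypothesis hC : hilbert_complete dot.

Local Notation norm := (hnorm dot).

(** The Baire category argument with nested balls.  If the family is bounded
    on some ball, it is bounded on the unit ball by homogeneity.  Otherwise
    every ball contains a smaller one on which some [p i] is at least [n], and
    the common point of such balls contradicts pointwise boundedness.  The
    statement is about seminorms so that it covers both vectors seen as
    functionals and operators. *)
Lemma uniform_boundedness (I : Type) (p : I -> H -> R) :
  (forall i x y, p i (x + y) <= p i x + p i y) ->
  (forall i r x, p i (r%:C%C *: x) = `|r| * p i x) ->
  (forall i, exists M, forall x, p i x <= M * norm x) ->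
  (forall x, exists C, forall i, p i x <= C) ->
  exists C, forall i x, p i x <= C * norm x.
Proof.
move=> pD pZ pM pC.
have pN i x : p i (- x) = p i x.
  by rewrite -scaleN1r (_ : -1 = (-1)%:C%C) ?pZ ?normrN1 ?mul1r// rmorphN.
have [[x0 [r [n [r0 hr]]]]|] :=
    pselect (exists x0 r n, 0 < r /\ forall x i, norm (x - x0) <= r -> p i x <= n).
  exists (2 * n / r) => i x.
  have [->|x0'] := eqVneq x 0.
    by rewrite -(scale0r 0) (pZ i 0 0) (hnormZ dot 0 0) normr0 !mul0r mulr0.
  have nx : 0 < norm x.
    by rewrite lt_neqAle hnorm_ge0 andbT; apply: contra x0' => /eqP/esym/hnorm0_eq0->.
  have h1 := hr (x0 + (r / norm x)%:C%C *: x) i.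
  have h2 := hr x0 i.
  have h3 := pD i (x0 + (r / norm x)%:C%C *: x) (- x0).
  move: h1 h2 h3; rewrite addrAC subrr add0r hnorm0 hnormZ pN pZ.
  rewrite ger0_norm ?divr_ge0 ?(ltW r0) ?(ltW nx)// divfK ?gt_eqF//.
  move=> /(_ (lexx _)) h1 /(_ isT) h2 h3.
  have : r / norm x * p i x <= 2 * n by lra.
  rewrite -(@ler_pM2l _ (norm x / r)) ?divr_gt0//.
  by congr (_ <= _); field; rewrite ?gt_eqF.
move=> nb; exfalso.
have step (sn : (H * R) * nat) : exists s' : H * R, 0 < sn.1.2 ->
    [/\ 0 < s'.2, s'.2 <= sn.1.2 / 2 &
     forall y, norm (y - s'.1) <= s'.2 ->
       norm (y - sn.1.1) <= sn.1.2 /\ exists i, sn.2%:R <= p i y].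
  case: sn => -[x r] n /=.
  have [r0|r0] := ltP 0 r; last by exists (x, r) => r0'; exfalso; lra.
  have [x' [i [x'r pn]]] : exists x' i, norm (x' - x) <= r / 2 /\ n%:R < p i x'.
    apply: contrapT => h; apply: nb; exists x, (r / 2), n%:R; split; first by lra.
    move=> x' i x'r; rewrite leNgt; apply/negP => hn; apply: h.
    by exists x', i.
  have [M hM] := pM i.
  pose M' := `|M| + 1.
  have M'0 : 0 < M' by rewrite /M' ltr_wpDl.
  (* [p i] is [M']-Lipschitz, so it stays above [n] on this ball. *)
  exists (x', Num.min (r / 2) ((p i x' - n%:R) / M')) => _ /=; split.
  - by rewrite lt_min; apply/andP; split; [lra|rewrite divr_gt0// subr_gt0].
  - by rewrite ge_min lexx.
  - move=> y; rewrite le_min => /andP[y1 y2]; split.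
      by have := ler_hnorm_tri dot x' y x; lra.
    exists i; have := pD i y (x' - y); rewrite addrC subrK.
    have := hM (x' - y); rewrite hnorm_distC.
    move: y2; rewrite ler_pdivlMr// => y2 h1 h2.
    have : M * norm (y - x') <= M' * norm (y - x').
      by rewrite ler_wpM2r ?hnorm_ge0// (le_trans (ler_norm _))// lerDl.
    lra.
have [F FP] := choice step.
pose s := fix s n := if n is k.+1 then F (s k, k) else (0, 1).
have s0 n : 0 < (s n).2 by elim: n => [|n IH] //=; have [] := FP (s n, n) IH.
have sP n := FP (s n, n) (s0 n).
have s_le n : (s n).2 <= (1 / 2) ^+ n.
  elim: n => [|n IH]; first by rewrite expr0.
  by have [_ h _] := sP n; rewrite exprS; move: h => /=; lra.
have nest m n : (m <= n)%N -> forall y, norm (y - (s n).1) <= (s n).2 ->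
    norm (y - (s m).1) <= (s m).2.
  elim: n => [|n IH]; first by rewrite leqn0 => /eqP ->.
  rewrite leq_eqVlt => /orP[/eqP -> //|mn] y hy; apply: IH => //.
  by have [_ _ h] := sP n; exact: (h y hy).1.
have sin m n : (m <= n)%N -> norm ((s n).1 - (s m).1) <= (s m).2.
  by move=> mn; apply: (nest _ _ mn); rewrite subrr hnorm0 ltW.
have c0 : (s n).2 @[n --> \oo] --> (0 : R).
  apply: (@squeeze_cvgr _ _ _ _ (cst 0) (fun n => (1 / 2) ^+ n)).
  - by apply: nearW => n; rewrite ltW//= s_le.
  - exact: cvg_cst.
  - by apply: cvg_expr; rewrite ger0_norm; lra.
have [x hx] : exists x, hcvg dot (fun n => (s n).1) x.
  apply: (complete_cvg hC _ c0) => m n mn.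
  by rewrite hnorm_distC sin.
have xin m : norm (x - (s m).1) <= (s m).2.
  apply/ler_addgt0Pr => e e0; have [N hN] := (hcvgP dot _ _).1 hx e e0.
  have := hN _ (leq_maxl N m); have := sin _ _ (leq_maxr N m).
  have := ler_hnorm_tri dot (s (maxn N m)).1 x (s m).1.
  by rewrite (hnorm_distC _ x (s (maxn N m)).1); lra.
have [C hCx] := pC x.
have [_ _ hs] := sP (Num.truncn C).+1.
have [_ [i hi]] := hs x (xin (Num.truncn C).+2).
have := hCx i; have := truncnS_gt C.
move: hi => /= hi h1 h2.
have : (Num.truncn C).+1%:R <= C by lra.
by rewrite leNgt h1.
Qed.

End UniformBoundedness.

(** * Direct sum of two copies of a Hilbert space *)

Section DirectSum.
Context {R : realType} {H : lmodType R[i]}.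
Variable dot : {dot H for Num.conj}.

(** The Hilbert direct sum of two copies of [H] is used twice: regularized
    inverses are projections onto a graph, and equality of two vector
    functionals is one orthogonality relation in the sum. *)
Definition pdot (x y : H * H) : R[i] := dot x.1 y.1 + dot x.2 y.2.

Let pdotP a (x y z : H * H) : pdot (a *: x + y) z = a * pdot x z + pdot y z.
Proof. by rewrite /pdot/= !linearPl/= mulrDr addrACA. Qed.

Let pdotC x y : pdot x y = (-1) ^+ false * (pdot y x)^*.
Proof.
rewrite /pdot hermC/= (hermC _ x.2)/= rmorphD !expr0 !mul1r; reflexivity.
Qed.

Let pdot_bilinear : bilinear_for ( *%R ) (Num.conj \; *%R) pdot.
Proof.
split=> [z a x y|x a y z]; first exact: pdotP.
rewrite pdotC pdotP !expr0 !mul1r rmorphD rmorphM/=.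
by congr (_ * _ + _); rewrite [RHS]pdotC mul1r.
Qed.

HB.instance Definition _ := @bilinear_isBilinear.Build R[i] (H * H)%type (H * H)%type R[i]
  ( *%R ) (Num.conj \; *%R) pdot pdot_bilinear.

Let pdot_gt0 x : x != 0 -> 0 < pdot x x.
Proof.
case: x => a b ab0; rewrite /pdot/= lt_neqAle addr_ge0 ?dnorm_ge0// andbT eq_sym.
rewrite paddr_eq0 ?dnorm_ge0// !dnorm_eq0; apply: contra ab0.
by move=> /andP[/eqP -> /eqP ->].
Qed.

HB.instance Definition _ := @isHermitianSesquilinear.Build R[i] (H * H)%type
  false Num.conj pdot pdotC.
HB.instance Definition _ := @isDotProduct.Build R[i] (H * H)%type pdot pdot_gt0.

Definition sum_dot : {dot (H * H)%type for Num.conj} := pdot.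

Lemma rdot_sum x y : rdot sum_dot x y = rdot dot x.1 y.1 + rdot dot x.2 y.2.
Proof. by rewrite /rdot raddfD. Qed.

Lemma hnorm_sum2 x : hnorm sum_dot x ^+ 2 = hnorm dot x.1 ^+ 2 + hnorm dot x.2 ^+ 2.
Proof. by rewrite !hnormE rdot_sum. Qed.

Lemma hnorm_fst x : hnorm dot x.1 <= hnorm sum_dot x.
Proof.
rewrite -(@ler_pXn2r _ 2) ?nnegrE ?hnorm_ge0//.
by rewrite hnorm_sum2 lerDl sqr_ge0.
Qed.

Lemma hnorm_snd x : hnorm dot x.2 <= hnorm sum_dot x.
Proof.
rewrite -(@ler_pXn2r _ 2) ?nnegrE ?hnorm_ge0//.
by rewrite hnorm_sum2 lerDr sqr_ge0.
Qed.

Lemma hnorm_sum_le x : hnorm sum_dot x <= hnorm dot x.1 + hnorm dot x.2.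
Proof.
rewrite -(@ler_pXn2r _ 2) ?nnegrE ?addr_ge0 ?hnorm_ge0//.
by rewrite hnorm_sum2; have := hnorm_ge0 dot x.1; have := hnorm_ge0 dot x.2; nra.
Qed.

Lemma hcvg_fst u x : hcvg sum_dot u x -> hcvg dot (fun n => (u n).1) x.1.
Proof. by move=> ux; apply: hcvg_bounded_dist ux => n; rewrite (hnorm_fst (u n - x)). Qed.

Lemma hcvg_snd u x : hcvg sum_dot u x -> hcvg dot (fun n => (u n).2) x.2.
Proof. by move=> ux; apply: hcvg_bounded_dist ux => n; rewrite (hnorm_snd (u n - x)). Qed.

Lemma sum_complete : hilbert_complete dot -> hilbert_complete sum_dot.
Proof.
move=> hC u uC.
have [a ha] : exists a, forall e : R, 0 < e -> exists N, forall n,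
    (N <= n)%N -> hnorm dot ((u n).1 - a) < e.
  apply: hC => e /uC[N hN]; exists N => m n Nm Nn.
  exact: le_lt_trans (hnorm_fst (u m - u n)) (hN _ _ Nm Nn).
have [b hb] : exists a, forall e : R, 0 < e -> exists N, forall n,
    (N <= n)%N -> hnorm dot ((u n).2 - a) < e.
  apply: hC => e /uC[N hN]; exists N => m n Nm Nn.
  exact: le_lt_trans (hnorm_snd (u m - u n)) (hN _ _ Nm Nn).
exists (a, b) => e e0; have e2 : 0 < e / 2 by rewrite divr_gt0.
have [N1 h1] := ha _ e2; have [N2 h2] := hb _ e2.
exists (maxn N1 N2) => n; rewrite geq_max => /andP[/h1 ? /h2 ?].
have /= := hnorm_sum_le (u n - (a, b)); lra.
Qed.
End DirectSum.

(** * Regularized inverses *)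

Section Tikhonov.
Context {R : realType} {H : lmodType R[i]}.
Variable dot : {dot H for Num.conj}.
Hypothesis hC : hilbert_complete dot.
Implicit Types (x y z v : H) (e : R).

Local Notation "'[ x , y ]" := (rdot dot x y).
Local Notation norm := (hnorm dot).

Variable w : H -> H.
Hypothesis bw : bounded_op dot w.

(** Normal equation [w* (y - w z) = e^2 z] of the minimization of
    [|y - w z|^2 + e^2 |z|^2], so that [z = (w* w + e^2)^-1 w* y].  Stating it
    weakly makes linearity, norm bounds and commutation statements about [z]
    follow from uniqueness, with no operator inverse to construct. *)
Definition tikhonov e y z := forall v, '[y - w z, w v] = e ^+ 2 * '[z, v].

(** Project [(y, 0)] onto the closed subspace of all [(w v, e v)]. *)
Lemma tikhonov_ex e y : 0 < e -> exists z, tikhonov e y z.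
Proof.
move=> e0.
have [|q1 q2 r /= h1 h2|u q hu uq|p /= Np hp] := @orthogonal_projection _ _ (sum_dot dot)
    [set q | w q.2 = e%:C%C *: q.1] (y, 0) (sum_complete hC).
- by rewrite /= -(scale0r 0) (bounded_opZ _ _ bw) !scale0r scaler0.
- rewrite (bounded_opD _ _ bw) (bounded_opZ _ _ bw) h1 h2 scalerDr.
  by rewrite !scalerA (mulrC r%:C%C).
- rewrite /=; apply: (@hcvg_unique _ _ dot (fun n => w (u n).2)).
    exact: hcvg_op bw (hcvg_snd uq).
  rewrite (_ : (fun _ => _) = (fun n => e%:C%C *: (u n).1)); last first.
    by apply/funext => n; exact: hu.
  apply: (@hcvg_lip _ _ dot (fun v => e%:C%C *: v) e _ _ _ (hcvg_fst uq)).
  by move=> n; rewrite -scalerBr hnormZ gtr0_norm.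
have eK : e%:C%C != 0 :> R[i] by rewrite eq_complex/= gt_eqF.
pose z := (e^-1)%:C%C *: p.2.
have wz : w z = p.1.
  rewrite /z (bounded_opZ _ _ bw) Np scalerA -rmorphM/= mulVf ?gt_eqF//.
  by rewrite scale1r.
have ez : p.2 = e%:C%C *: z.
  by rewrite /z scalerA -rmorphM/= mulfV ?gt_eqF// scale1r.
exists z => v; have := hp (w v, e%:C%C *: v); rewrite /= (bounded_opZ _ _ bw).
move=> /(_ erefl); rewrite rdot_sum/= wz sub0r rdotNl rdotZr ez rdotZl.
by move/eqP; rewrite subr_eq0 => /eqP ->; rewrite mulrA -expr2.
Qed.

Lemma tikhonov_unique e y z z' : 0 < e -> tikhonov e y z -> tikhonov e y z' -> z = z'.
Proof.
move=> e0 hz hz'; apply/eqP; rewrite -subr_eq0; apply/eqP/(@hnorm0_eq0 _ _ dot).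
have := hz (z - z'); have := hz' (z - z'); rewrite !(bounded_opB _ _ bw).
rewrite !(rdotBl, rdotBr) => h1 h2.
have h3 : e ^+ 2 * norm (z - z') ^+ 2 + norm (w z - w z') ^+ 2 = 0.
  by rewrite !hnormE !(rdotBl, rdotBr); lra.
apply/eqP; rewrite -sqrf_eq0; move/eqP: h3.
have p1 : 0 <= e ^+ 2 * norm (z - z') ^+ 2 by exact: mulr_ge0 (sqr_ge0 _) (sqr_ge0 _).
rewrite (paddr_eq0 p1 (sqr_ge0 _)) mulf_eq0 sqrf_eq0 gt_eqF ?exprn_gt0//=.
by case/andP.
Qed.

Lemma tikhonovP e (c : R[i]) y y' z z' : tikhonov e y z -> tikhonov e y' z' ->
  tikhonov e (c *: y + y') (c *: z + z').
Proof.
move=> hz hz' v; rewrite (bounded_opD _ _ bw) (bounded_opZ _ _ bw) opprD addrACA -scalerBr.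
rewrite rdotDl hz' (rdotDl _ (c *: z)) mulrDr; congr (_ + _).
by rewrite !rdot_conjl -(bounded_opZ _ _ bw) hz.
Qed.

Lemma tikhonov_bound e : 0 < e ->
  exists M, forall y z, tikhonov e y z -> norm z <= M * norm y.
Proof.
move=> e0; have [M M0 wM] := bounded_op_bound bw; exists (M / e ^+ 2) => y z hz.
have := hnorm_ge0 dot z; rewrite le_eqVlt => /orP[/eqP <-|n0].
  by rewrite mulr_ge0 ?hnorm_ge0 ?divr_ge0 ?ltW ?exprn_gt0.
rewrite mulrAC ler_pdivlMr ?exprn_gt0//.
rewrite -(@ler_pM2r _ (norm z))//.
have := hz z; rewrite rdotBl -!hnormE => h.
have := cauchy_schwarz dot y (w z); have := wM z; have := hnorm_ge0 dot y.
have := sqr_ge0 (norm (w z)); nra.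
Qed.

(** [(w* w + e^2)^-1 w* w] is a contraction: test the equation on [x - z]. *)
Lemma tikhonov_contraction e x z : 0 < e -> tikhonov e (w x) z -> norm z <= norm x.
Proof.
move=> e0 hz; have := hz (x - z).
rewrite -(bounded_opB _ _ bw) -hnormE rdotBr -hnormE => h.
have h1 : 0 <= '[z, x] - norm z ^+ 2.
  by rewrite -(@pmulr_rge0 _ (e ^+ 2)) ?exprn_gt0// -h sqr_ge0.
have := cauchy_schwarz dot z x; have := hnorm_ge0 dot z; have := hnorm_ge0 dot x.
by rewrite !le_eqVlt => /orP[/eqP?|?] /orP[/eqP?|?]; nra.
Qed.

Lemma tikhonov_commute e (B : H -> H) y z : bounded_op dot B ->
  w \o B = B \o w -> w \o adj dot B = adj dot B \o w ->
  tikhonov e y z -> tikhonov e (B y) (B z).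
Proof.
move=> bB wB wB' hz v.
have := congr1 (@^~ z) wB => /= ->; rewrite -(bounded_opB _ _ bB) !(adjE hC _ _ bB).
by have := congr1 (@^~ v) wB' => /= <-; rewrite hz.
Qed.

(** Bounded approximate solutions of [w z = y] converge in norm.  Subtracting
    the equations for two parameters and testing on the difference [d] of the
    solutions gives [|d|^2 <= |u n|^2 - |u m|^2], so [u] is Cauchy because the
    squared norms are monotone and bounded. *)
Lemma tikhonov_limit (u : nat -> H) y (K : R) :
  (forall z, adj dot w z = 0 -> z = 0) ->
  (forall n, tikhonov (n.+1%:R^-1) y (u n)) -> (forall n, norm (u n) <= K) ->
  exists2 z, w z = y & norm z <= K.
Proof.
move=> kw hu uK; pose h n : R := n.+1%:R^-1.
have h0 n : 0 < h n by rewrite invr_gt0.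
have hcv : h n @[n --> \oo] --> (0 : R) by exact: cvg_harmonic.
pose a n := norm (u n) ^+ 2.
have key m n : (m <= n)%N -> norm (u m - u n) ^+ 2 <= a n - a m.
  move=> mn; have hmn : h n ^+ 2 <= h m ^+ 2.
    have hh : h n <= h m by rewrite lef_pV2 ?posrE// ler_nat.
    by rewrite ler_pXn2r// nnegrE ltW.
  have hn2 : 0 < h n ^+ 2 by rewrite exprn_gt0.
  have [d un] : exists d, u n = u m + d by exists (u n - u m); rewrite addrC subrK.
  have e1 := hu m d; have e2 := hu n d.
  have : (h m ^+ 2 - h n ^+ 2) * '[u m, d] = norm (w d) ^+ 2 + h n ^+ 2 * norm d ^+ 2.
    move: e1 e2; rewrite un (bounded_opD _ _ bw) -/(h m) -/(h n) !hnormE.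
    by rewrite !(rdotBl, rdotDl); lra.
  have := sqr_ge0 (norm (w d)); have := sqr_ge0 (norm d).
  rewrite hnorm_distC /a un [u m + d - _]addrAC subrr add0r (hnormE _ (u m + d)) !(rdotDl, rdotDr) (rdotC _ d (u m)).
  rewrite -!hnormE; move: (h m ^+ 2) (h n ^+ 2) hmn hn2 => E F.
  rewrite le_eqVlt => /orP[/eqP EF|EF] F0 d0 wd0 hh; last first.
    have : 0 <= '[u m, d].
      rewrite -(@pmulr_rge0 _ (E - F)) ?subr_gt0// hh.
      by rewrite addr_ge0// mulr_ge0// ltW.
    by lra.
  have /eqP : F * norm d ^+ 2 = 0.
    have := mulr_ge0 (ltW F0) d0; rewrite EF subrr mul0r in hh *; lra.
  rewrite mulf_eq0 gt_eqF//= sqrf_eq0 => /eqP/hnorm0_eq0 ->.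
  by rewrite rdot0r hnorm0; lra.
have K0 : 0 <= K by exact: le_trans (hnorm_ge0 dot (u 0%N)) (uK _).
have aK n : a n <= K ^+ 2 by rewrite ler_pXn2r ?nnegrE ?hnorm_ge0.
have a_nd : nondecreasing_seq a.
  by move=> m n mn; rewrite -subr_ge0 (le_trans _ (key _ _ mn))// sqr_ge0.
have a_ub : has_ubound (range a) by exists (K ^+ 2) => _ [n _ <-].
have acv := nondecreasing_cvgn a_nd a_ub.
set L := sup _ in acv.
have aL n : a n <= L by apply: ub_le_sup => //; exists n.
have [z uz] : exists z, hcvg dot u z.
  apply: (@complete_cvg _ _ dot u (fun m => Num.sqrt (L - a m)) hC).
    move=> m n mn; rewrite -(@ler_pXn2r _ 2) ?nnegrE ?hnorm_ge0 ?sqrtr_ge0//.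
    rewrite [leRHS]sqr_sqrtr ?subr_ge0//; apply: (le_trans (key _ _ mn)).
    by rewrite lerB.
  rewrite -[X in _ --> X](@sqrtr0 R) -(subrr L).
  apply: (@cvg_comp _ _ _ (fun m => L - a m) Num.sqrt); last exact: sqrt_continuous.
  by apply: cvgB => //; exact: cvg_cst.
exists z; last first.
  have c2 : (fun=> K) n @[n --> \oo] --> K by exact: cvg_cst.
  apply: ler_cvg_to (hcvg_norm uz) c2 _.
  exact: nearW.
apply/esym/eqP; rewrite -subr_eq0; apply/eqP/kw.
apply: (@rdot_inj _ _ dot) => v; rewrite rdot0l adjEl//.
apply: (@seq_limit_unique _ (fun n => '[y - w (u n), w v])).
  rewrite rdotBl; under eq_fun do rewrite rdotBl.
  by apply: cvgB; [exact: cvg_cst|exact: hcvg_rdot (hcvg_op bw uz)].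
apply: (@cvg_bounded_dist _ _ (fun n => h n ^+ 2 * (K * norm v))).
  move=> n; rewrite subr0 hu -/(h n) normrM ger0_norm ?sqr_ge0//.
  rewrite ler_wpM2l ?sqr_ge0// (le_trans (cauchy_schwarz_abs _ _ _))//.
  by rewrite ler_wpM2r ?hnorm_ge0.
rewrite -[X in _ --> X](mul0r (K * norm v)); apply: cvgMr_tmp.
by rewrite -[X in _ --> X](mulr0 0); apply: cvgM.
Qed.
End Tikhonov.

(** * Bicommutants and vector functionals *)

Section Projector.
Context {R : realType} {H : lmodType R[i]}.
Variable dot : {dot H for Num.conj}.
Hypothesis hC : hilbert_complete dot.
Variable N : set H.
Hypothesis N0 : N 0.
Hypothesis NP : forall (c : R[i]) v w, N v -> N w -> N (c *: v + w).

Local Notation "'[ x , y ]" := (rdot dot x y).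
Local Notation norm := (hnorm dot).

Lemma projection_unique x p q : N p -> N q ->
  (forall v, N v -> '[x - p, v] = 0) -> (forall v, N v -> '[x - q, v] = 0) ->
  p = q.
Proof.
move=> Np Nq hp hq; apply/eqP; rewrite -subr_eq0; apply/eqP/(@hnorm0_eq0 _ _ dot).
have Npq : N (p - q) by rewrite addrC -scaleN1r; exact: NP.
apply/eqP; rewrite -sqrf_eq0 hnormE; apply/eqP.
have := hp _ Npq; have := hq _ Npq.
by rewrite !rdotBl => h1 h2; lra.
Qed.

(** The orthogonal projection onto a closed complex subspace is a bounded
    operator; linearity is uniqueness of the projection. *)
Lemma projector_ex :
  (forall u v, (forall n, N (u n)) -> hcvg dot u v -> N v) ->
  exists Q : H -> H, [/\ bounded_op dot Q, forall x, N (Q x) &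
    forall x v, N v -> '[x - Q x, v] = 0].
Proof.
move=> Ncl.
have /choice[Q hQ] : forall x, exists p, N p /\ forall v, N v -> '[x - p, v] = 0.
  move=> x; have [|||p Np hp] := @orthogonal_projection _ _ dot N x hC => //.
    by move=> v w r Nv Nw; rewrite addrC; exact: NP.
  by exists p.
exists Q; split; [|by move=> x; exact: (hQ x).1|by move=> x; exact: (hQ x).2].
split.
  move=> c x y; apply: (@projection_unique (c *: x + y)).
  - exact: (hQ _).1.
  - by apply: NP; exact: (hQ _).1.
  - exact: (hQ _).2.
  - move=> v Nv; rewrite opprD addrACA -scalerBr rdotDl rdot_conjl.
    rewrite (hQ x).2 ?(hQ y).2 ?addr0//.
    by rewrite -[_ *: v]addr0; exact: NP.
exists 1 => x; rewrite mul1r -(@ler_pXn2r _ 2) ?nnegrE ?hnorm_ge0//.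
have := (hQ x).2 _ (hQ x).1; rewrite rdotBl -hnormE => h.
have := cauchy_schwarz dot x (Q x); have := hnorm_ge0 dot x; have := hnorm_ge0 dot (Q x).
rewrite le_eqVlt => /orP[/eqP <- _ _|n0 x0 cs]; first by rewrite expr0n/= sqr_ge0.
have : norm (Q x) <= norm x by rewrite -(@ler_pM2r _ (norm (Q x)))// -expr2; lra.
by move=> hQx; rewrite ler_pXn2r ?nnegrE ?hnorm_ge0.
Qed.
End Projector.

Section Bicommutant.
Context {R : realType} {H : lmodType R[i]}.
Variable dot : {dot H for Num.conj}.
Hypothesis hC : hilbert_complete dot.
Variable S : set (H -> H).
Hypothesis Sb : forall A, S A -> bounded_op dot A.
Hypothesis Sadj : forall A, S A ->
  exists2 B, S B & forall x y, rdot dot (A x) y = rdot dot x (B y).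

Local Notation "'[ x , y ]" := (rdot dot x y).
Local Notation norm := (hnorm dot).
Local Notation M := (bicommutant dot S).
Implicit Types (x y z : H) (T A B w : H -> H).

Lemma commutantE (U : set (H -> H)) T A x : commutant dot U T -> U A ->
  T (A x) = A (T x).
Proof. by move=> [_ h] /h /(congr1 (@^~ x)). Qed.

Lemma commutant_adj B : commutant dot S B -> commutant dot S (adj dot B).
Proof.
move=> cB; have bB := cB.1; split; first exact: adj_bounded.
move=> A SA; apply/funext => x /=; apply: (@rdot_inj _ _ dot) => y.
have [A' SA' hA] := Sadj SA.
by rewrite adjEl// !hA adjEl// (commutantE _ cB).
Qed.

Lemma bicommutant_comm T B : M T -> commutant dot S B -> T \o B = B \o T.
Proof. by move=> [_ h] /h. Qed.

Lemma bicommutant_comm_adj T B : M T -> commutant dot S B ->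
  T \o adj dot B = adj dot B \o T.
Proof. by move=> [_ h] /commutant_adj /h. Qed.

Lemma sub_bicommutant A : S A -> M A.
Proof.
move=> SA; split; first exact: Sb.
by move=> B cB; apply/funext => x /=; rewrite (commutantE _ cB).
Qed.

Lemma bicommutant_comp T A : M T -> M A -> M (T \o A).
Proof.
move=> MT MA; split.
  have [[lT [m1 h1]] _] := MT; have [[lA [m2 h2]] _] := MA; split.
    by move=> c x y /=; rewrite lA lT.
  have [m [m0 hm]] := bounded_op_bound MT.1.
  exists (m * m2) => x /=; rewrite -mulrA (le_trans (hm _))//.
  by rewrite ler_pM2l.
by move=> B cB; apply/funext => x /=; rewrite (commutantE _ MA)// (commutantE _ MT).
Qed.

(** Let [N] be the subspace of the direct sum orthogonal to all
    [(A xi, A xi')] with [A] in [S].  It is stable under [A (+) A], so the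
    projection [Q] onto it commutes with these operators, and the four blocks
    of [Q] are in the commutant of [S].  Hence [Q] commutes with [T (+) T],
    which therefore maps [(xi, xi')], a vector killed by [Q], to another one;
    the conclusion is its orthogonality to [(eta, - eta')], which is in [N] by
    hypothesis. *)
Lemma bicommutant_functional xi eta xi' eta' :
  S idfun -> (forall A B, S A -> S B -> S (A \o B)) ->
  (forall A, S A -> dot (A xi) eta = dot (A xi') eta') ->
  forall T, M T -> dot (T xi) eta = dot (T xi') eta'.
Proof.
move=> Sid Scomp hS T MT.
pose D := sum_dot dot.
pose N : set (H * H) := [set q | forall A c, S A -> rdot D (A xi, A xi') (c *: q) = 0].
have N0 : N 0 by move=> A c _; rewrite scaler0 rdot0r.
have NP (c : R[i]) v v' : N v -> N v' -> N (c *: v + v').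
  by move=> Nv Nv' A c' SA; rewrite scalerDr rdotDr scalerA Nv ?Nv'// addr0.
have [|Q [bQ NQ hQ]] := @projector_ex _ _ D (sum_complete hC) N N0 NP.
  move=> u v Nu uv A c SA; rewrite rdot_conj rdotC.
  apply: (@seq_limit_unique _ (fun n => rdot D (u n) (c^*%C *: (A xi, A xi')))).
    exact: hcvg_rdot.
  rewrite (_ : (fun _ => _) = cst 0); first exact: cvg_cst.
  by apply/funext => n; rewrite rdotC -rdot_conj Nu.
have NS A q : S A -> N q -> N (A q.1, A q.2).
  move=> SA Nq B c SB; have [A' SA' hA] := Sadj SA.
  rewrite rdot_sum/= -!(bounded_opZ _ _ (Sb SA)) rdotC hA rdotC.
  rewrite addrC rdotC hA rdotC addrC.
  have := Nq (A' \o B) c (Scomp _ _ SA' SB).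
  by rewrite rdot_sum.
have QS A q : S A -> Q (A q.1, A q.2) = (A (Q q).1, A (Q q).2).
  move=> SA; apply: (@projection_unique _ _ D N NP (A q.1, A q.2)).
  - exact: NQ.
  - by apply: NS => //; exact: NQ.
  - exact: hQ.
  - move=> v Nv; have [A' SA' hA] := Sadj SA.
    rewrite rdot_sum/= -!(bounded_opB _ _ (Sb SA)) !hA.
    by have := hQ q _ (NS _ _ SA' Nv); rewrite rdot_sum.
have [m [m0 Qm]] := bounded_op_bound bQ.
(* The blocks of [Q] are [j \o Q \o i], with [i] one of the two injections
   and [j] one of the two projections. *)
have block (i : H -> H * H) (j : H * H -> H) :
    linear i -> linear j -> (forall x, hnorm D (i x) <= norm x) ->
    (forall q, norm (j q) <= hnorm D q) ->
    (forall A x, S A -> i (A x) = (A (i x).1, A (i x).2)) ->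
    (forall A q, j (A q.1, A q.2) = A (j q)) ->
    forall x, T (j (Q (i x))) = j (Q (i (T x))).
  move=> li lj ni nj Ai Aj x.
  have cB : commutant dot S (fun x => j (Q (i x))).
    split; last first.
      by move=> A SA; apply/funext => z /=; rewrite Ai// QS// Aj.
    split; first by move=> c z z' /=; rewrite li (bQ.1) lj.
    exists m => z; rewrite (le_trans (nj _))// (le_trans (Qm _))//.
    by rewrite ler_pM2l.
  exact: (commutantE x MT cB).
have Ql (x x' : H) : Q (x, x') = Q (x, 0) + Q (0, x').
  rewrite -(bounded_opD _ _ bQ); congr Q.
  by rewrite -[RHS]/((x + 0, 0 + x')) addr0 add0r.
have S0 A : S A -> A 0 = 0.
  by move=> SA; rewrite (bounded_op0 (Sb SA)).
have inl_lin : linear (fun x : H => (x, 0 : H)).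
  by move=> c x y; rewrite -[RHS]/((c *: x + y, c *: 0 + 0)) scaler0 addr0.
have inr_lin : linear (fun x : H => (0 : H, x)).
  by move=> c x y; rewrite -[RHS]/((c *: 0 + 0, c *: x + y)) scaler0 addr0.
have inl_n (x : H) : hnorm D (x, 0) <= norm x.
  by rewrite (le_trans (hnorm_sum_le _ _))//= hnorm0 addr0.
have inr_n (x : H) : hnorm D (0, x) <= norm x.
  by rewrite (le_trans (hnorm_sum_le _ _))//= hnorm0 add0r.
have QT x x' : Q (T x, T x') = (T (Q (x, x')).1, T (Q (x, x')).2).
  rewrite (Ql (T x)) (Ql x x') /= !(bounded_opD _ _ MT.1).
  have il A z : S A -> (A z, 0 : H) = (A (z, 0 : H).1, A (z, 0 : H).2).
    by move=> SA /=; rewrite S0.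
  have ir A z : S A -> (0 : H, A z) = (A (0 : H, z).1, A (0 : H, z).2).
    by move=> SA /=; rewrite S0.
  have lf : linear (@fst H H) by [].
  have ls : linear (@snd H H) by [].
  rewrite (block _ _ inl_lin lf inl_n (hnorm_fst dot) il (fun _ _ => erefl)).
  rewrite (block _ _ inl_lin ls inl_n (hnorm_snd dot) il (fun _ _ => erefl)).
  rewrite (block _ _ inr_lin lf inr_n (hnorm_fst dot) ir (fun _ _ => erefl)).
  rewrite (block _ _ inr_lin ls inr_n (hnorm_snd dot) ir (fun _ _ => erefl)).
  by case: (Q (T x, 0)) (Q (0, T x')) => ? ? [].
have Qxi : Q (xi, xi') = 0.
  apply: (@projection_unique _ _ D N NP (xi, xi')) => //; first exact: hQ.
  by move=> v Nv; rewrite subr0; have := Nv idfun 1 Sid; rewrite scale1r.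
have Neta c : N (c *: (eta, - eta')).
  move=> A c' SA; rewrite scalerA; move: (c' * c) => {}c.
  rewrite rdot_sum/= /rdot !linearZr_LR/= linearNr hS//.
  by rewrite -raddfD/= mulrN subrr.
apply: dot_rdot => c.
have := hQ (T xi, T xi') _ (Neta c).
rewrite QT Qxi/=.
have T0 := bounded_op0 MT.1.
rewrite T0 rdotBl rdot_sum/= [rdot D _ _]rdot_sum/= !rdot0l addr0 subr0.
by rewrite scalerN rdotNr => /eqP; rewrite subr_eq0 => /eqP.
Qed.

End Bicommutant.

(** * Factorization in a bicommutant *)

Section Factor.
Context {R : realType} {H : lmodType R[i]}.
Variable dot : {dot H for Num.conj}.
Hypothesis hC : hilbert_complete dot.
Variable S : set (H -> H).
Hypothesis Sb : forall A, S A -> bounded_op dot A.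
Hypothesis Sadj : forall A, S A ->
  exists2 B, S B & forall x y, rdot dot (A x) y = rdot dot x (B y).

Local Notation "'[ x , y ]" := (rdot dot x y).
Local Notation norm := (hnorm dot).
Local Notation M := (bicommutant dot S).
Implicit Types (x y z : H) (T A B w : H -> H).

(** The solution operator [(w* w + e^2)^-1 w*] stays in the von Neumann
    algebra: uniqueness turns [tikhonov_commute] into commutation with every
    element of the commutant. *)
Lemma tikhonov_op w (e : R) : 0 < e -> M w ->
  exists2 T, M T & forall y, tikhonov dot w e y (T y).
Proof.
move=> e0 Mw; have bw := Mw.1.
have /choice[T hT] := fun y => tikhonov_ex hC bw y e0.
have uniq := tikhonov_unique bw e0.
exists T => //; split; first split.
- by move=> c x y; apply: (uniq (c *: x + y)) => //; exact: tikhonovP.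
- by have [m hm] := tikhonov_bound bw e0; exists m => x; exact: hm (hT x).
- move=> B cB; apply/funext => x /=; apply: (uniq (B x)) => //.
  apply: tikhonov_commute => //; first exact: cB.1.
    exact: bicommutant_comm Mw cB.
  exact: bicommutant_comm_adj Mw cB.
Qed.

(** The first use of uniform boundedness, for fixed [x], bounds the vectors
    [T (w1 x)] by testing them against each [y]; the second one makes that
    bound uniform in [x]. *)
Lemma uniform_domination w1 w2 : M w1 -> M w2 ->
  (forall x y, exists x' y', forall T, M T ->
      '[T (w1 x), y] = '[T (w2 x'), y']) ->
  exists C : R, forall T, M T -> (forall x, norm (T (w2 x)) <= norm x) ->
    forall x, norm (T (w1 x)) <= C * norm x.
Proof.
move=> M1 M2 h.
pose I := {T | M T /\ forall x, norm (T (w2 x)) <= norm x}.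
have weak x : exists C, forall i : I, norm (sval i (w1 x)) <= C.
  have [i y z|i r y|i|y|C hCx] :=
      @uniform_boundedness _ _ dot hC I (fun i y => `|'[sval i (w1 x), y]|).
  - by rewrite rdotDr ler_normD.
  - by rewrite rdotZr normrM.
  - by exists (norm (sval i (w1 x))) => y; exact: cauchy_schwarz_abs.
  - have [x' [y' hxy]] := h x y; exists (norm x' * norm y') => -[T [MT Tc]] /=.
    rewrite hxy// (le_trans (cauchy_schwarz_abs _ _ _))//.
    by rewrite ler_wpM2r ?hnorm_ge0.
  exists `|C| => i; set v := sval i (w1 x).
  have := hCx i v; rewrite -/v -hnormE ger0_norm ?sqr_ge0//.
  have := hnorm_ge0 dot v; rewrite le_eqVlt => /orP[/eqP <- //|v0].
  by rewrite expr2 ler_pM2r// => /le_trans; apply; exact: ler_norm.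
have [i x y|i r x|i|//|C hCx] :=
    @uniform_boundedness _ _ dot hC I (fun i x => norm (sval i (w1 x))).
- by case: i => T [MT _] /=; rewrite (bounded_opD _ _ M1.1) (bounded_opD _ _ MT.1) ler_hnormD.
- by case: i => T [MT _] /=; rewrite (bounded_opZ _ _ M1.1) (bounded_opZ _ _ MT.1) hnormZ.
- by case: i => T [MT _] /=; have [[_ ?] _] := bicommutant_comp MT M1.
by exists C => T MT Tc x; exact: (hCx (exist _ T (conj MT Tc)) x).
Qed.

(** The regularized solutions of [w2 z = w1 x] are bounded by
    [uniform_domination], hence converge to an exact solution, which is unique;
    sending [x] to it is the factor. *)
Theorem bicommutant_factor w1 w2 : M w1 -> M w2 ->
  trivial_kernel w2 -> trivial_kernel (adj dot w2) ->
  (forall x y, exists x' y', forall T, M T ->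
      '[T (w1 x), y] = '[T (w2 x'), y']) ->
  exists2 a, M a & w1 = w2 \o a.
Proof.
move=> M1 M2 k2 k2' h.
have [C hCd] := uniform_domination M1 M2 h.
have /choice[T hT] : forall n : nat, exists T, M T /\
    forall y, tikhonov dot w2 n.+1%:R^-1 y (T y).
  move=> n; have [|T MT hT] := @tikhonov_op w2 n.+1%:R^-1 _ M2; last by exists T.
  by rewrite invr_gt0.
have /choice[a ha] : forall x, exists z, w2 z = w1 x /\ norm z <= C * norm x.
  move=> x.
  have [n|z z1 z2] := @tikhonov_limit _ _ dot hC w2 M2.1 (fun n => T n (w1 x)) (w1 x)
      (C * norm x) k2' (fun n => (hT n).2 _); last by exists z.
  apply: hCd; first exact: (hT n).1.
  move=> y; apply: (tikhonov_contraction M2.1 _ ((hT n).2 (w2 y))).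
  by rewrite invr_gt0.
have inj x y : w2 x = w2 y -> x = y.
  move=> xy; apply/eqP; rewrite -subr_eq0; apply/eqP/k2.
  by rewrite (bounded_opB _ _ M2.1) xy subrr.
exists a; last by apply/funext => x /=; rewrite (ha x).1.
split; first split.
- move=> c x y; apply: inj; rewrite (bounded_opD _ _ M2.1) (bounded_opZ _ _ M2.1).
  by rewrite !(ha _).1 (bounded_opD _ _ M1.1) (bounded_opZ _ _ M1.1).
- by exists C => x; exact: (ha x).2.
- move=> B cB; apply/funext => x /=; apply: inj.
  by rewrite (commutantE _ M2 cB) !(ha _).1 (commutantE _ M1 cB).
Qed.

End Factor.

(** * Completeness of L2 *)

Section FastLimit.
Context {R : realType}.

(** With [c k = sqrt s / 2^k], which bounds the [k]-th increment, the
    sequence [h k - 2 c k] increases and [h k + 2 c k] decreases.  This gives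
    the limit and the rate at once. *)
Lemma fast_limit (h : nat -> R) (s : R) :
  (forall k, 4 ^+ k * (h k.+1 - h k) ^+ 2 <= s) ->
  exists l, h @ \oo --> l /\ forall n, (l - h n) ^+ 2 <= 4 / 4 ^+ n * s.
Proof.
move=> hs.
have s0 : 0 <= s by apply: le_trans (hs 0%N); rewrite mul1r sqr_ge0.
pose c k := Num.sqrt s / 2 ^+ k.
have c0 k : 0 <= c k by rewrite divr_ge0 ?sqrtr_ge0 ?exprn_ge0.
have cS k : c k = 2 * c k.+1 by rewrite /c exprS; field; rewrite expf_neq0.
have csq k : c k ^+ 2 = s / 4 ^+ k.
  have -> : 4 = 2 ^+ 2 :> R by ring.
  by rewrite exprMn sqr_sqrtr// exprVn -!exprM mulnC.
have dk k : `|h k.+1 - h k| <= c k.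
  rewrite -(@ler_pXn2r _ 2) ?nnegrE// real_normK ?num_real// csq.
  by rewrite ler_pdivlMr ?exprn_gt0// mulrC.
pose b k := h k - 2 * c k; pose e k := h k + 2 * c k.
have b_nd : nondecreasing_seq b.
  apply/nondecreasing_seqP => k; have := dk k; rewrite /b ler_norml (cS k).
  by have := c0 k.+1; lra.
have e_ni : nonincreasing_seq e.
  apply/nonincreasing_seqP => k; have := dk k; rewrite /e ler_norml (cS k).
  by have := c0 k.+1; lra.
have be m n : b m <= e n.
  have h1 : b m <= b (maxn m n) by apply: b_nd; exact: leq_maxl.
  have h2 : e (maxn m n) <= e n by apply: e_ni; exact: leq_maxr.
  by move: h1 h2; rewrite /b /e; have := c0 (maxn m n); lra.
have b_ub : has_ubound (range b) by exists (e 0%N) => _ [n _ <-].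
have bcv := nondecreasing_cvgn b_nd b_ub.
set l := sup _ in bcv.
have bl n : b n <= l by apply: ub_le_sup => //; exists n.
have le n : l <= e n.
  by apply: ge_sup; [exists (b 0%N); exists 0%N|move=> _ [m _ <-]].
have ccv : c k @[k --> \oo] --> 0.
  rewrite -[X in _ --> X](mulr0 (Num.sqrt s)); apply: cvgMl_tmp.
  rewrite (_ : (fun _ => _) = (fun k => (1 / 2) ^+ k)); last first.
    by apply/funext => k; rewrite div1r exprVn.
  by apply: cvg_expr; rewrite ger0_norm; lra.
exists l; split.
  rewrite (_ : h = (fun k => b k + 2 * c k)); last first.
    by apply/funext => k; rewrite subrK.
  rewrite -[l]addr0 -[X in _ + X](mulr0 2).
  by apply: cvgD => //; apply: cvgMl_tmp.
move=> n; have -> : 4 / 4 ^+ n * s = (2 * c n) ^+ 2 by rewrite exprMn csq; lra.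
rewrite -real_normK ?num_real// ler_pXn2r ?nnegrE ?mulr_ge0//.
by rewrite ler_norml; have := bl n; have := le n; rewrite /b /e; lra.
Qed.
End FastLimit.

Section RealL2.
Context {d : measure_display} {T : measurableType d} {R : realType}.
Variable mu : {measure set T -> \bar R}.
Local Notation L := (Lfun mu 2%:E).

Lemma Lfun_measurable (f : T -> R) : f \in L -> measurable_fun setT f.
Proof. by case/andP; rewrite inE. Qed.

Lemma Lfun2_sqr (f : T -> R) : measurable_fun setT f ->
  (\int[mu]_t ((f t) ^+ 2)%:E < +oo)%E -> f \in L.
Proof.
move=> mf fi; apply/andP; split; rewrite inE//=.
rewrite /finite_norm unlock /Lnorm /=.
rewrite poweR_lty//; apply: le_lt_trans fi.
by under eq_integral => t _ do rewrite powR_mulrn// real_normK ?num_real//.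
Qed.

(** The series [S] of the weighted squared increments has a finite integral.
    Where [S] is finite, [fast_limit] gives a limit [g] with
    [(g - h n)^2 <= 4 / 4^n * S]; where [S] is infinite, the same bound holds
    for any choice of [g].  So convergence in mean needs only integration of
    this inequality, with neither Fatou nor an almost everywhere argument. *)
Lemma Lfun2_fast_limit (h : nat -> T -> R) :
  (forall n, h n \in L) ->
  (forall n, (\int[mu]_t (4 ^+ n * (h n.+1 t - h n t) ^+ 2)%:E <=
     (1 / (2 ^ n.+1)%:R)%:E)%E) ->
  exists2 g, g \in L &
    forall n, (\int[mu]_t ((g t - h n t) ^+ 2)%:E <= (4 / 4 ^+ n)%:E)%E.
Proof.
move=> hL hi; have mh n := Lfun_measurable (hL n).
pose a n t : \bar R := (4 ^+ n * (h n.+1 t - h n t) ^+ 2)%:E.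
have a0 n t : (0 <= a n t)%E by rewrite lee_fin mulr_ge0 ?sqr_ge0 ?exprn_ge0.
have ma n : measurable_fun setT (a n).
  apply/measurable_EFinP; apply: measurable_funM => //.
  by apply: measurable_funX; exact: measurable_funB.
pose S t := (\sum_(0 <= n <oo) a n t)%E.
have S0 t : (0 <= S t)%E by exact: nneseries_ge0.
have mS : measurable_fun setT S by exact: ge0_emeasurable_sum.
have aS n t : (a n t <= S t)%E.
  rewrite /S; apply: le_trans (nneseries_lim_ge n.+1 _) => //.
  by rewrite big_nat_recr//= leeDr// sume_ge0.
have iS : (\int[mu]_t S t <= 1)%E.
  rewrite integral_nneseries//; apply: le_trans (epsilon_trick0 xpredT ler01).
  by apply: lee_nneseries => [n _ _|n _]; [exact: integral_ge0|exact: hi].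
pose E := [set t | (S t < +oo)%E].
have mE : measurable E.
  by rewrite -[E]setTI; exact: emeasurable_fun_infty_o.
have /choice[g hg] : forall t, exists l,
    (fun n => h n t * \1_E t) @ \oo --> l /\
    forall n, (((l - h n t) ^+ 2)%:E <= (4 / 4 ^+ n)%:E * S t)%E.
  move=> t; have [Et|Et] := pselect (E t); last first.
    exists 0; split.
      rewrite indicE memNset//; under eq_fun do rewrite mulr0.
      exact: cvg_cst.
    move=> n; have -> : S t = +oo%E.
      by apply/eqP; rewrite eq_le leey/= leNgt; apply/negP.
    by rewrite gt0_muley ?leey// lte_fin divr_gt0 ?exprn_gt0.
  have Sfin : S t \is a fin_num by rewrite ge0_fin_numE.
  have [|l [hl ln]] := @fast_limit R (h ^~ t) (fine (S t)).
    by move=> k; rewrite -lee_fin fineK//; exact: aS.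
  exists l; split; last by move=> n; rewrite -(fineK Sfin) -EFinM lee_fin.
  by rewrite indicE mem_set//; under eq_fun do rewrite mulr1.
have mg : measurable_fun setT g.
  apply: (@measurable_fun_cvg _ _ _ _ (fun n t => h n t * \1_E t)).
    by move=> n; apply: measurable_funM => //; exact: measurable_indic.
  by move=> t _; exact: (hg t).1.
have gi n : (\int[mu]_t ((g t - h n t) ^+ 2)%:E <= (4 / 4 ^+ n)%:E)%E.
  have c0 : 0 <= 4 / 4 ^+ n :> R by rewrite divr_ge0 ?exprn_ge0.
  apply: (@le_trans _ _ (\int[mu]_t ((4 / 4 ^+ n)%:E * S t))%E).
    apply: ge0_le_integral => //.
    - by move=> t _; rewrite lee_fin sqr_ge0.
    - apply/measurable_EFinP; apply: measurable_funX; exact: measurable_funB.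
    - by apply: measurable_funeM.
    - by move=> t _; exact: (hg t).2.
  rewrite ge0_integralZl_EFin// -[leRHS]mule1.
  by apply: lee_wpmul2l.
exists g => //.
have := Lfun2D (Lfun2_sqr (f := fun t => g t - h 0%N t) _ _) (hL 0%N).
rewrite (_ : _ \+ _ = g); last by apply/funext => t /=; rewrite subrK.
apply; first exact: measurable_funB.
by apply: le_lt_trans (gi 0%N) _; rewrite ltry.
Qed.
End RealL2.

Section L2complete.
Context {d : measure_display} {T : measurableType d} {R : realType}.
Variable mu : {measure set T -> \bar R}.
Local Notation norm := (hnorm (L2dot mu)).

Lemma hnorm_L2class (f : L2fun mu) :
  ((norm (L2class f) ^+ 2)%:E = \int[mu]_t (complex.Re (f t) ^+ 2)%:E +
     \int[mu]_t (complex.Im (f t) ^+ 2)%:E)%E.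
Proof.
have [iR _] := Cintegrable_mulJ f f.
have -> : norm (L2class f) ^+ 2 = complex.Re (L2dot mu (L2class f) (L2class f)).
  exact: hnormE.
rewrite L2dotE /Cintegral /= /Rintegral fineK; last first.
  exact: integrable_fin_num.
have iR2 := Lfun2_integrable_sqr (L2fun_Re f).
have iI2 := Lfun2_integrable_sqr (L2fun_Im f).
rewrite -integralD//; apply: eq_integral => t _.
by rewrite -EFinD; congr EFin; case: (f t) => a b /=; rewrite mulrN opprK !expr2.
Qed.

(** A subsequence with fast decreasing increments converges in mean,
    separately for the real and the imaginary part. *)
Lemma L2_complete : hilbert_complete (L2dot mu).
Proof.
move=> u uC.
(* Squared, these increments absorb the weight [4^k] of the fast limit. *)
have e0 k : 0 < 1 / 4 ^+ k.+1 :> R by rewrite divr_gt0 ?exprn_gt0.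
have /choice[N hN] : forall k, exists N, forall m n, (N <= m)%N -> (N <= n)%N ->
  norm (u m - u n) < 1 / 4 ^+ k.+1 by move=> k; exact: uC.
pose nk k := (\max_(i < k.+1) N i)%N.
have Nnk j k : (j <= k)%N -> (N j <= nk k)%N.
  by move=> jk; exact: (@leq_bigmax _ (fun i : 'I_k.+1 => N i) (Ordinal (jk : j < k.+1)%N)).
pose f k : L2fun mu := repr (u (nk k)).
have fE k : u (nk k) = L2class (f k) by rewrite reprL2.
have dist (g g' : L2fun mu) : L2class g - L2class g' = L2class (g - g').
  rewrite -[RHS]addr0 -(subrr (L2class g')) addrA; congr (_ - _).
  by rewrite L2class_add subrK.
have fast k : ((norm (L2class (f k.+1 - f k)) ^+ 2)%:E <= (1 / (16 ^+ k.+1))%:E)%E.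
  rewrite -dist -!fE lee_fin.
  have := hN k (nk k.+1) (nk k) (Nnk _ _ (leqnSn k)) (Nnk _ _ (leqnn k)).
  rewrite -(@ltr_pXn2r _ 2) ?nnegrE ?hnorm_ge0 ?(ltW (e0 _))// => /ltW/le_trans; apply.
  rewrite expr_div_n expr1n -exprM mulnC exprM.
  by rewrite (_ : 4 ^+ 2 = 16 :> R)//; ring.
have wt k (F : T -> R) : measurable_fun setT F ->
    (\int[mu]_t (F t ^+ 2)%:E <= (1 / (16 ^+ k.+1))%:E)%E ->
    (\int[mu]_t (4 ^+ k * (F t) ^+ 2)%:E <= (1 / (2 ^ k.+1)%:R)%:E)%E.
  move=> mF hF; under eq_integral do rewrite EFinM.
  have p0 : (0 : R) <= 4 ^+ k by rewrite exprn_ge0.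
  rewrite ge0_integralZl_EFin//; last 2 first.
  - by move=> t _; rewrite lee_fin sqr_ge0.
  - by apply/measurable_EFinP; exact: measurable_funX.
  apply: (@le_trans _ _ ((4 ^+ k)%:E * (1 / 16 ^+ k.+1)%:E)%E).
    by apply: lee_wpmul2l.
  rewrite -EFinM lee_fin !div1r.
  have -> : 4 ^+ k / 16 ^+ k.+1 = 16^-1 * (4 ^+ k)^-1 :> R.
    have -> : 16 = 4 * 4 :> R by ring.
    by rewrite exprMn exprS; field; rewrite expf_neq0.
  rewrite -invfM lef_pV2 ?posrE ?mulr_gt0 ?exprn_gt0 ?ltr0n ?expn_gt0//.
  rewrite natrX exprS ler_pM ?exprn_ge0//; first lra.
  by apply: lerXn2r; rewrite ?nnegrE//; lra.
have fB k t : (f k.+1 - f k : L2fun mu) t = f k.+1 t - f k t by [].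
have [gR gRL hR] : exists2 g, g \in Lfun mu 2%:E & forall n,
    (\int[mu]_t ((g t - complex.Re (f n t)) ^+ 2)%:E <= (4 / 4 ^+ n)%:E)%E.
  apply: (@Lfun2_fast_limit _ _ _ mu (fun k t => complex.Re (f k t))).
    by move=> n; exact: L2fun_Re.
  move=> n; apply: (wt n (fun t => complex.Re (f n.+1 t) - complex.Re (f n t))).
    by apply: measurable_funB; apply: Lfun_measurable; exact: L2fun_Re.
  apply: le_trans (fast n); rewrite hnorm_L2class.
  rewrite -[leLHS]adde0; apply: leeD; last by apply: integral_ge0 => t _; rewrite lee_fin sqr_ge0.
  by rewrite le_eqVlt; apply/orP; left; apply/eqP/eq_integral => t _; rewrite fB raddfB.
have [gI gIL hI] : exists2 g, g \in Lfun mu 2%:E & forall n,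
    (\int[mu]_t ((g t - complex.Im (f n t)) ^+ 2)%:E <= (4 / 4 ^+ n)%:E)%E.
  apply: (@Lfun2_fast_limit _ _ _ mu (fun k t => complex.Im (f k t))).
    by move=> n; exact: L2fun_Im.
  move=> n; apply: (wt n (fun t => complex.Im (f n.+1 t) - complex.Im (f n t))).
    by apply: measurable_funB; apply: Lfun_measurable; exact: L2fun_Im.
  apply: le_trans (fast n); rewrite hnorm_L2class.
  rewrite -[leLHS]add0e; apply: leeD; first by apply: integral_ge0 => t _; rewrite lee_fin sqr_ge0.
  by rewrite le_eqVlt; apply/orP; left; apply/eqP/eq_integral => t _; rewrite fB raddfB.
have gP : (fun t => (gR t +i* gI t)%C) \in sqint mu.
  by rewrite inE; apply/andP; split.
pose g := MkL2fun gP.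
have gB k t : (g - f k : L2fun mu) t = g t - f k t by [].
have lim k : norm (u (nk k) - L2class g) <= 3 / 2 ^+ k.
  rewrite hnorm_distC fE dist -(@ler_pXn2r _ 2) ?nnegrE ?hnorm_ge0 ?divr_ge0 ?exprn_ge0//.
  rewrite -lee_fin hnorm_L2class.
  apply: (@le_trans _ _ ((4 / 4 ^+ k)%:E + (4 / 4 ^+ k)%:E)%E).
    apply: leeD.
      by apply: le_trans (hR k); rewrite le_eqVlt; apply/orP; left; apply/eqP/eq_integral => t _; rewrite gB raddfB.
    by apply: le_trans (hI k); rewrite le_eqVlt; apply/orP; left; apply/eqP/eq_integral => t _; rewrite gB raddfB.
  rewrite -EFinD lee_fin expr_div_n -exprM mulnC exprM.
  have -> : 2 ^+ 2 = 4 :> R by ring.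
  have : 0 <= (4 ^+ k)^-1 :> R by rewrite invr_ge0 exprn_ge0.
  by move: (_^-1) => p; lra.
exists (L2class g) => e e_gt0.
have : (3 / 2 ^+ k + 1 / 4 ^+ k.+1) @[k --> \oo] --> (0 : R).
  rewrite -[X in _ --> X]addr0; apply: cvgD.
    rewrite -[X in _ --> X](mulr0 3); apply: cvgMl_tmp.
    under eq_fun do rewrite -exprVn.
    by apply: cvg_expr; rewrite ger0_norm; lra.
  rewrite -[X in _ --> X](mulr0 4^-1).
  under eq_fun do rewrite div1r -exprVn exprS.
  apply: cvgMl_tmp.
  by apply: cvg_expr; rewrite ger0_norm; lra.
move=> /cvgrPdist_lt/(_ e e_gt0)[k _ /(_ k (leqnn k))].
rewrite /= sub0r normrN => /(le_lt_trans (ler_norm _)) hk.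
exists (N k) => n Nn.
apply: (le_lt_trans (ler_hnorm_tri _ (u (nk k)) _ _)).
apply: le_lt_trans hk; rewrite addrC lerD ?lim// ltW// hN//.
exact: Nnk.
Qed.
End L2complete.

(** * The left regular representation *)

Section LeftRegular.
Context {G : topologicalGroupType} {R : realType}.
Variable mu : {measure set (borel G) -> \bar R}.
Hypothesis hmu : left_haar mu.
Local Notation dotG := (L2dot mu).
Local Notation norm := (hnorm (L2dot mu)).
Implicit Types (s t : G) (x y : L2 mu) (f g : L2fun mu).

Lemma measurable_translation s :
  measurable_fun setT (fun t : borel G => (s^-1 * t)%g : borel G).
Proof.
have cont : continuous (fun t : G => (s^-1 * t)%g).
  move=> t; have h := @mulg_continuous G ((s^-1)%g, t).
  have k : (fun t : G => ((s^-1)%g, t)) u @[u --> t] --> ((s^-1)%g, t).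
    by apply: cvg_pair; [exact: cvg_cst|exact: cvg_id].
  exact: (@cvg_comp _ _ _ _ _ _ _ _ k h).
apply: (@measurability _ _ (borel G) (borel G) setT (fun t => (s^-1 * t)%g) (@open G)) => //.
move=> _ [U oU <-]; rewrite setTI; apply: sub_sigma_algebra.
by move/continuousP: cont; exact.
Qed.

Lemma integral_translation s (F : borel G -> \bar R) :
  measurable_fun setT F -> (forall t, 0 <= F t)%E ->
  (\int[mu]_t F (s^-1 * t)%g = \int[mu]_t F t)%E.
Proof.
move=> mF F0.
have := ge0_integral_pushforward (measurable_translation s) mu measurableT mF.
rewrite preimage_setT => <-; last by move=> y _; exact: F0.
apply: eq_measure_integral => [|mF' A mA _]; first exact: measurable_translation.
rewrite -(haar_invariant hmu s mA); congr (mu _).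
apply/seteqP; split => [t At|_ [t At <-]].
  by exists (s^-1 * t)%g => //; rewrite mulgA mulgV mul1g.
by rewrite /= mulgA mulVg mul1g.
Qed.

Definition L2translate s f : L2fun mu :=
  MkL2fun (translate_sqint hmu s (valP f)).

Lemma lambda_class s f : lambda mu s (L2class f) = L2class (L2translate s f).
Proof. by apply: (lambdaE hmu); exact: aeW. Qed.

Lemma lambda_linear s : linear (lambda mu s).
Proof.
move=> a x y.
elim/(@L2ind _ _ _ mu): x => f; elim/(@L2ind _ _ _ mu): y => g.
rewrite [a *: _]L2class_scale L2class_add !lambda_class.
rewrite [a *: _]L2class_scale L2class_add; congr L2class.
exact: val_inj.
Qed.

Lemma lambda1 : lambda mu 1%g = idfun.
Proof.
apply/funext => x; elim/(@L2ind _ _ _ mu): x => f; rewrite lambda_class; congr L2class.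
by apply: val_inj; apply/funext => t; rewrite /= /translate invg1 mul1g.
Qed.

Lemma lambdaM s t : lambda mu s \o lambda mu t = lambda mu (s * t)%g.
Proof.
apply/funext => x; elim/(@L2ind _ _ _ mu): x => f /=.
rewrite (lambda_class t) (lambda_class s) (lambda_class (s * t)%g); congr L2class.
by apply: val_inj; apply/funext => r; rewrite /= /translate /= invgM -mulgA.
Qed.

Lemma lambda_norm s x : norm (lambda mu s x) = norm x.
Proof.
elim/(@L2ind _ _ _ mu): x => f; rewrite lambda_class; apply/eqP.
rewrite -(@eqrXn2 _ 2) ?hnorm_ge0//; apply/eqP/EFin_inj; rewrite !hnorm_L2class.
have mR := Lfun_measurable (L2fun_Re f); have mI := Lfun_measurable (L2fun_Im f).
congr (_ + _)%E.
- apply: (integral_translation s (F := fun t => (complex.Re (f t) ^+ 2)%:E)).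
    by apply/measurable_EFinP; exact: measurable_funX.
  by move=> t; rewrite lee_fin sqr_ge0.
- apply: (integral_translation s (F := fun t => (complex.Im (f t) ^+ 2)%:E)).
    by apply/measurable_EFinP; exact: measurable_funX.
  by move=> t; rewrite lee_fin sqr_ge0.
Qed.

Lemma lambda_bounded s : bounded_op dotG (lambda mu s).
Proof.
by split; [exact: lambda_linear|exists 1 => x; rewrite lambda_norm mul1r].
Qed.

(** Polarizing [lambda_norm], [lambda s] preserves inner products, and
    [lambda s^-1] is its inverse. *)
Lemma lambda_adj s x y :
  rdot dotG (lambda mu s x) y = rdot dotG x (lambda mu s^-1%g y).
Proof.
have iso a b : rdot dotG (lambda mu s a) (lambda mu s b) = rdot dotG a b.
  have := lambda_norm s (a + b); rewrite (bounded_opD _ _ (lambda_bounded s)).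
  move=> /(congr1 (fun r => r ^+ 2)); rewrite !hnormE !(rdotDl, rdotDr) -!hnormE.
  by rewrite !lambda_norm (rdotC _ b) (rdotC _ (lambda mu s b)); lra.
rewrite -[RHS]iso; congr rdot.
by have := congr1 (@^~ y) (lambdaM s s^-1%g) => /= ->; rewrite mulgV lambda1.
Qed.

(** * Weighted Fourier algebras *)

Let S : set (L2 mu -> L2 mu) := range (lambda mu).

Lemma range_lambda_bounded A : S A -> bounded_op dotG A.
Proof. by move=> [s _ <-]; exact: lambda_bounded. Qed.

Lemma range_lambda_adj A : S A ->
  exists2 B, S B & forall x y, rdot dotG (A x) y = rdot dotG x (B y).
Proof.
move=> [s _ <-]; exists (lambda mu s^-1%g); first by exists (s^-1%g).
by move=> x y; exact: lambda_adj.
Qed.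

(** The pairing of VN(G) with A(G) depends on the coefficient only, not on
    the vectors that represent it. *)
Lemma coef_functional xi eta xi' eta' : coef mu xi eta = coef mu xi' eta' ->
  forall T, VN mu T -> dotG (T xi) eta = dotG (T xi') eta'.
Proof.
move=> hc T MT.
apply: (bicommutant_functional (@L2_complete _ _ _ mu) range_lambda_bounded
  range_lambda_adj _ _ _ MT).
- by exists 1%g => //; exact: lambda1.
- by move=> _ _ [s _ <-] [t _ <-]; exists (s * t)%g => //; rewrite lambdaM.
- by move=> _ [s _ <-]; exact: (congr1 (@^~ s) hc).
Qed.

Lemma VN_lambda s : VN mu (lambda mu s).
Proof. by apply: (sub_bicommutant range_lambda_bounded); exists s. Qed.

Lemma VN_comp T A : VN mu T -> VN mu A -> VN mu (T \o A).
Proof. exact: bicommutant_comp. Qed.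

Lemma pairing_coef T xi eta : VN mu T ->
  pairing mu T (coef mu xi eta) = dotG (T xi) eta.
Proof.
move=> MT; rewrite /pairing; case: xgetP => [z _ [xi' [eta' [h ->]]]|].
  by apply: coef_functional => //; rewrite h.
by move=> /(_ (dotG (T xi) eta)); case; exists xi, eta.
Qed.

(** The values at the translations, which belong to VN(G), already pin down
    the function that [vn_act] selects. *)
Lemma vn_act_coef T xi eta : VN mu T ->
  vn_act mu T (coef mu xi eta) = coef mu (T xi) eta.
Proof.
move=> MT; rewrite /vn_act; case: xgetP => [g _ [[xi' [eta' ->]] h]|].
  apply/funext => s; have := h _ (VN_lambda s).
  by rewrite !pairing_coef//; [exact: VN_comp (VN_lambda s) MT|exact: VN_lambda].
move=> /(_ (coef mu (T xi) eta)); case; split; first by exists (T xi), eta.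
by move=> A MA; rewrite !pairing_coef//; exact: VN_comp.
Qed.

Lemma weighted_fourierE w : VN mu w ->
  weighted_fourier mu w = [set u | exists x y, u = coef mu (w x) y].
Proof.
move=> Mw; apply/seteqP; split => [_ [_ [x [y ->]] <-]|_ [x [y ->]]].
  by exists x, y; rewrite vn_act_coef.
by exists (coef mu x y); [exists x, y|rewrite vn_act_coef].
Qed.

Lemma weighted_fourier_comp w a : VN mu w -> VN mu a ->
  weighted_fourier mu (w \o a) `<=` weighted_fourier mu w.
Proof.
move=> Mw Ma; rewrite !weighted_fourierE//; last exact: VN_comp.
by move=> _ [x [y ->]]; exists (a x), y.
Qed.

Lemma weighted_fourier_factor w1 w2 : VN mu w1 -> VN mu w2 ->
  trivial_kernel w2 -> trivial_kernel (adj dotG w2) ->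
  weighted_fourier mu w1 `<=` weighted_fourier mu w2 ->
  exists2 a, VN mu a & w1 = w2 \o a.
Proof.
move=> M1 M2 k2 k2'; rewrite !weighted_fourierE// => h.
apply: (bicommutant_factor (@L2_complete _ _ _ mu) range_lambda_adj M1 M2 k2 k2') => x y.
have [|x' [y' e]] := h (coef mu (w1 x) y); first by exists x, y.
by exists x', y' => T MT; exact: (congr1 (@complex.Re R) (coef_functional e MT)).
Qed.

End LeftRegular.

Lemma trivial_kernel_cancel {R : realType} {H : lmodType R[i]}
    (dot : {dot H for Num.conj}) (w a : H -> H) :
  bounded_op dot w -> trivial_kernel w -> w = w \o a -> a = idfun.
Proof.
move=> bw kw wa; apply/funext => x /=; apply/eqP; rewrite -subr_eq0; apply/eqP/kw.
by rewrite (bounded_opB _ _ bw); have := congr1 (@^~ x) wa => /= <-; rewrite subrr.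
Qed.

Theorem proposition2p6 (R : realType) (G : topologicalGroupType)
    (hG : locally_compact_group G)
    (mu : {measure set (borel G) -> \bar R}) (hmu : left_haar mu)
    (K : lmodType R[i]) (kdot : {dot K for Num.conj})
    (tens : {bilinear L2 mu -> L2 mu -> K})
    (htens : hilbert_tensor (L2dot mu) kdot tens)
    (Gamma : (L2 mu -> L2 mu) -> (K -> K))
    (hGamma : comultiplication mu kdot tens Gamma)
    (omega1 omega2 : L2 mu -> L2 mu)
    (h1 : weight_inverse mu kdot tens Gamma omega1)
    (h2 : weight_inverse mu kdot tens Gamma omega2) :
  (weighted_fourier mu omega1 `<=` weighted_fourier mu omega2 ->
     exists2 a, VN mu a & omega1 = omega2 \o a) /\
  (weighted_fourier mu omega1 = weighted_fourier mu omega2 <->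
     exists2 a, invertible_in (VN mu) a & omega1 = omega2 \o a).
Proof.
have [M1 _ k1 k1'] := h1; have [M2 _ k2 k2'] := h2.
split; first exact: weighted_fourier_factor.
split=> [e|[a [Ma [b [Mb ab ba]]] e]].
  have [|a Ma ea] := weighted_fourier_factor hmu M1 M2 k2 k2'; first by rewrite e.
  have [|b Mb eb] := weighted_fourier_factor hmu M2 M1 k1 k1'; first by rewrite e.
  exists a => //; split => //; exists b; split => //.
    by apply: (trivial_kernel_cancel M2.1 k2); rewrite compA -ea.
  by apply: (trivial_kernel_cancel M1.1 k1); rewrite compA -eb.
apply/seteqP; split; first by rewrite e; exact: weighted_fourier_comp.
have -> : omega2 = omega1 \o b by rewrite e -compA ab.
exact: weighted_fourier_comp.
Qed.
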